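(* Consider the DVR algorithm (described in the context) run with $$p_{\rm comm} = \Big(1 + \gamma \frac{m + \kappa_s}{\kappa_{\rm comm}}\Big)^{-1},\qquad p_{ij} \propto (1 - p_{\rm comm})\Big(1 + \frac{L_{ij}}{\sigma_i}\Big),$$ where the normalization of $p_{ij}$ is such that $\sum_{j=1}^m p_{ij} = 1-p_{\rm comm}$ for every $i$, and with $$\alpha = 2\lambda_{\min}^+(A_{\rm comm}^\top D_M^{-1} A_{\rm comm}),\qquad \eta = \min\left( \frac{p_{\rm comm}}{\lambda_{\max}(A_{\rm comm}^\top \Sigma_{\rm comm} A_{\rm comm})},\ \min_{i,j}\frac{p_{ij}}{\alpha(1 + \sigma_i^{-1}L_{ij})} \right).$$ Then there exists $C_0 > 0$ that only depends on $\theta_0$ (initial conditions) such that for all $t > 0$, $$\mathbb{E}\left[\sum_{i=1}^n\frac{1}{2}\|\theta^{(i)}_t - \theta^\star\|^2\right] \leq C_0\left(1 - \frac{\alpha \eta}{2}\right)^t,$$ where $\theta^\star$ is the minimizer of $F$, and so the expected time $T_\varepsilon$ required to reach precision $\varepsilon$ satisfies $$T_\varepsilon = O\left(\left[2(m + \kappa_s) + \tau \frac{\kappa_{\rm comm}}{\gamma}\right]\log\varepsilon^{-1}\right).$$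
   Context: Problem. There are $n$ nodes linked by a connected undirected graph $G$ with $E$ edges (communication edges). Minimize over $x\in\mathbb{R}^d$ $$F(x) = \sum_{i=1}^n f_i(x),\qquad f_i(x) = \frac{\sigma_i}{2}\|x\|^2 + \sum_{j=1}^m f_{ij}(x),$$ with $\sigma_i>0$ and each $f_{ij}:\mathbb{R}^d\to\mathbb{R}$ convex, $L_{ij}$-smooth (and twice differentiable). The stochastic condition number is $\kappa_s = \max_i (1+\sum_{j=1}^m L_{ij})/\sigma_i$. Matrices. $\lambda_{\min}^+$ and $\lambda_{\max}$ denote the smallest non-zero and the largest eigenvalue. Each communication edge $(k,\ell)$ (with an arbitrary fixed orientation) has a weight $\mu_{k\ell}>0$. $A_{\rm comm}\in\mathbb{R}^{nd\times Ed}$ is defined by $A_{\rm comm}(e_{k,\ell}\otimes z) = \mu_{k\ell}(u_k-u_\ell)\otimes z$ for $z\in\mathbb{R}^d$, where $e_{k,\ell}$ and $u_k$ are the unit vectors associated with edge $(k,\ell)$ and node $k$. The gossip matrix $W\in\mathbb{R}^{n\times n}$ is defined by $W\otimes I_d = A_{\rm comm}A_{\rm comm}^\top$, and $\gamma=\lambda_{\min}^+(W)/\lambda_{\max}(W)$. $\Sigma_{\rm comm} = {\rm Diag}(\sigma_1^{-1},\dots,\sigma_n^{-1})\otimes I_d$. $P_{ij}$ is the orthogonal projector on $(\cap_{x\in\mathbb{R}^d}{\rm Ker}(\nabla^2 f_{ij}(x)))^\perp$, so $\nabla^2 f_{ij}(x)\preccurlyeq L_{ij}P_{ij}$ for all $x$.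 $D_M$ is the diagonal matrix with entries $(D_M)_{ii} = \sigma_i+\lambda_{\max}(\sum_{j=1}^m L_{ij}P_{ij})$, (tensored with $I_d$). Finally $$\kappa_{\rm comm} = \gamma\,\frac{\lambda_{\max}(A_{\rm comm}^\top\Sigma_{\rm comm}A_{\rm comm})}{\lambda_{\min}^+(A_{\rm comm}^\top D_M^{-1}A_{\rm comm})}.$$ DVR algorithm. Start from arbitrary $z_0^{(ij)}\in\mathbb{R}^d$ and set $\theta_0^{(i)} = -\sigma_i^{-1}\sum_{j=1}^m\nabla f_{ij}(z_0^{(ij)})$. View $\theta_t$ as a matrix in $\mathbb{R}^{n\times d}$ with rows $\theta_t^{(i)}$. At each iteration $t$, independently of the past: - with probability $p_{\rm comm}$ (communication step): $\theta_{t+1}=\theta_t-\frac{\eta}{p_{\rm comm}}{\rm Diag}(\sigma_1^{-1},\dots,\sigma_n^{-1})W\theta_t$ and $z_{t+1}=z_t$; - otherwise (computation step): every node $i$ samples one index $j\in\{1,\dots,m\}$, in such a way that the overall (unconditional) probability that $f_{ij}$ is sampled at iteration $t$ is $p_{ij}$; then $z_{t+1}^{(ij)} = (1-\frac{\alpha\eta}{p_{ij}})z_t^{(ij)}+\frac{\alpha\eta}{p_{ij}}\theta_t^{(i)}$, $z_{t+1}^{(ij')}=z_t^{(ij')}$ for $j'\neq j$, and $\theta_{t+1}^{(i)} = \theta_t^{(i)}-\frac1{\sigma_i}(\nabla f_{ij}(z_{t+1}^{(ij)})-\nabla f_{ij}(z_t^{(ij)}))$. Time model. A computation step (one stochastic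 gradient per node, in parallel) takes time $1$ and a communication step (multiplication by $W$) takes time $\tau$. The expected time to reach precision $\varepsilon$ is the expected time needed to run a number $K_\varepsilon$ of iterations such that $C_0\left(1-\frac{\alpha\eta}{2}\right)^{K_\varepsilon}\leq\varepsilon$, where $C_0\left(1-\frac{\alpha\eta}{2}\right)^{t}$ is the bound on the expected error $\mathbb{E}\left[\sum_{i=1}^n\frac12\|\theta_t^{(i)}-\theta^\star\|^2\right]$ after $t$ iterations. *)

(* Defs.v *)
From HB Require Import structures.
From mathcomp Require Import all_boot all_order all_algebra.
From mathcomp Require Import mxtens.
From mathcomp Require Import all_classical all_reals all_analysis.

Set Implicit Arguments.
Unset Strict Implicit.
Unset Printing Implicit Defensive.
Import Order.TTheory GRing.Theory Num.Theory.
Import numFieldNormedType.Exports.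

Local Open Scope classical_set_scope.
Local Open Scope ring_scope.

(* The library norm `|x| on 'rV[R]_d is the sup norm; the Euclidean structure
   is therefore defined by hand.  The two norms are equivalent, so
   differentiability is unaffected. *)
Definition dotp (R : realType) (d : nat) (u v : 'rV[R]_d) : R :=
  \sum_(k < d) u 0 k * v 0 k.

Definition enorm (R : realType) (d : nat) (u : 'rV[R]_d) : R :=
  Num.sqrt (dotp u u).

Definition grad (R : realType) (d : nat) (f : 'rV[R]_d -> R) (x : 'rV[R]_d) :
    'rV[R]_d :=
  \row_(k < d) 'D_(delta_mx 0 k) f x.

(* Row-vector convention of 'J: v *m hessian f x is the derivative of grad f
   at x along v. *)
Definition hessian (R : realType) (d : nat) (f : 'rV[R]_d -> R)
    (x : 'rV[R]_d) : 'M[R]_d :=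
  'J (grad f) x.

Definition twice_differentiable (R : realType) (d : nat)
    (f : 'rV[R]_d -> R) : Prop :=
  (forall x, differentiable f x) /\ (forall x, differentiable (grad f) x).

Definition smooth (R : realType) (d : nat) (L : R) (f : 'rV[R]_d -> R) : Prop :=
  forall x y, enorm (grad f x - grad f y) <= L * enorm (x - y).

Definition orthogonal_compl (R : realType) (d : nat) (K : set 'rV[R]_d) :
    set 'rV[R]_d :=
  [set v | forall w, K w -> dotp v w = 0].

Definition is_orthogonal_projector (R : realType) (d : nat) (P : 'M[R]_d)
    (S : set 'rV[R]_d) : Prop :=
  [/\ P^T = P, P *m P = P & range (fun v : 'rV[R]_d => v *m P) = S].

Definition common_hessian_kernel (R : realType) (d : nat)
    (f : 'rV[R]_d -> R) : set 'rV[R]_d :=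
  \bigcap_(x in [set: 'rV[R]_d]) [set v | v *m hessian f x = 0].

(* Only used for symmetric matrices with an eigenvalue (resp. a nonzero
   eigenvalue): the set is then finite and nonempty, so that sup and inf are
   a maximum and a minimum. *)
Definition lambda_max (R : realType) (k : nat) (M : 'M[R]_k) : R :=
  sup [set a | eigenvalue M a].

Definition lambda_min_pos (R : realType) (k : nat) (M : 'M[R]_k) : R :=
  inf [set a | eigenvalue M a /\ a != 0].

(* src and dst list every edge of the simple graph adj exactly once, with an
   arbitrary orientation. *)
Definition edge_orientation (n E : nat) (adj : rel 'I_n)
    (src dst : 'I_E -> 'I_n) : Prop :=
  (forall e, adj (src e) (dst e)) /\
  (forall k l, adj k l ->
     exists! e, (src e = k /\ dst e = l) \/ (src e = l /\ dst e = k)).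

Definition connected_graph (n : nat) (adj : rel 'I_n) : Prop :=
  [/\ symmetric adj, irreflexive adj & forall k l, connect adj k l].

(* Column e of the left factor is mu_e (u_k - u_l) for e = (k, l), whence
   A_comm (e_{k,l} (x) z) = mu_{kl} (u_k - u_l) (x) z. *)
Definition A_comm (R : realType) (n E d : nat) (src dst : 'I_E -> 'I_n)
    (mu : 'I_E -> R) : 'M[R]_(n * d, E * d) :=
  (\matrix_(i < n, e < E) (mu e * ((i == src e)%:R - (i == dst e)%:R)))
    *t (1%:M : 'M[R]_d).

Definition Sigma_comm (R : realType) (n d : nat) (sigma : 'I_n -> R) :
    'M[R]_(n * d) :=
  diag_mx (\row_(i < n) (sigma i)^-1) *t (1%:M : 'M[R]_d).

Definition D_M (R : realType) (n m d : nat) (sigma : 'I_n -> R)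
    (L : 'I_n -> 'I_m -> R) (P : 'I_n -> 'I_m -> 'M[R]_d) : 'M[R]_(n * d) :=
  diag_mx (\row_(i < n) (sigma i + lambda_max (\sum_(j < m) L i j *: P i j)))
    *t (1%:M : 'M[R]_d).

Definition objective (R : realType) (n m d : nat) (sigma : 'I_n -> R)
    (f : 'I_n -> 'I_m -> 'rV[R]_d -> R) (x : 'rV[R]_d) : R :=
  \sum_(i < n) (sigma i / 2 * enorm x ^+ 2 + \sum_(j < m) f i j x).

Record dvr_state (R : realType) (n m d : nat) := DVRState {
  dvr_z : 'I_n -> 'I_m -> 'rV[R]_d;
  dvr_theta : 'M[R]_(n, d)
}.

(* Outcome of the sampling at one iteration: None is a communication step,
   Some J a computation step in which node i samples the index J i. *)
Definition dvr_choice (n m : nat) : Type := option {ffun 'I_n -> 'I_m}.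

Definition dvr_init (R : realType) (n m d : nat) (sigma : 'I_n -> R)
    (f : 'I_n -> 'I_m -> 'rV[R]_d -> R) (z0 : 'I_n -> 'I_m -> 'rV[R]_d) :
    dvr_state R n m d :=
  DVRState z0
    (\matrix_(i < n) (- (sigma i)^-1 *: \sum_(j < m) grad (f i j) (z0 i j))).

Definition dvr_step (R : realType) (n m d : nat) (sigma : 'I_n -> R)
    (f : 'I_n -> 'I_m -> 'rV[R]_d -> R) (W : 'M[R]_n)
    (p_comm : R) (p : 'I_n -> 'I_m -> R) (alpha eta : R)
    (c : dvr_choice n m) (s : dvr_state R n m d) : dvr_state R n m d :=
  let: DVRState z theta := s in
  match c with
  | None =>
      DVRState z
        (theta - (eta / p_comm) *:
                   (diag_mx (\row_(i < n) (sigma i)^-1) *m W *m theta))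
  | Some J =>
      let z' i j :=
        if j == J i then
          (1 - alpha * eta / p i j) *: z i j
            + (alpha * eta / p i j) *: row i theta
        else z i j in
      DVRState z'
        (\matrix_(i < n)
           (row i theta - (sigma i)^-1 *:
              (grad (f i (J i)) (z' i (J i)) - grad (f i (J i)) (z i (J i)))))
  end.

Fixpoint dvr_run (R : realType) (n m d : nat) (sigma : 'I_n -> R)
    (f : 'I_n -> 'I_m -> 'rV[R]_d -> R) (W : 'M[R]_n)
    (p_comm : R) (p : 'I_n -> 'I_m -> R) (alpha eta : R)
    (z0 : 'I_n -> 'I_m -> 'rV[R]_d) (c : nat -> dvr_choice n m) (t : nat) :
    dvr_state R n m d :=
  if t is t'.+1 then
    dvr_step sigma f W p_comm p alpha eta (c t')
      (dvr_run sigma f W p_comm p alpha eta z0 c t')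
  else dvr_init sigma f z0.

(* The choice at iteration t is independent of the previous ones.  The joint
   law of the indices sampled by the different nodes is only constrained
   through its marginals p i j, which are unconditional probabilities. *)
Definition dvr_sampling (R : realType) (n m : nat) (p_comm : R)
    (p : 'I_n -> 'I_m -> R) (dsp : measure_display) (T : measurableType dsp)
    (Pr : probability T R) (xi : nat -> T -> dvr_choice n m) : Prop :=
  [/\ forall t c, measurable (xi t @^-1` [set c]),
      forall t (h : nat -> dvr_choice n m),
        Pr [set w | forall u, (u <= t)%N -> xi u w = h u] =
        (Pr [set w | forall u, (u < t)%N -> xi u w = h u] *
         Pr [set w | xi t w = h t])%E,
      forall t, Pr [set w | xi t w = None] = p_comm%:E &
      forall t i j,
        Pr [set w | exists2 J, xi t w = Some J & J i = j] = (p i j)%:E].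

Definition sq_error (R : realType) (n m d : nat) (theta_star : 'rV[R]_d)
    (s : dvr_state R n m d) : R :=
  \sum_(i < n) 1 / 2 * enorm (row i (dvr_theta s) - theta_star) ^+ 2.

Definition step_time (R : realType) (n m : nat) (tau : R)
    (c : dvr_choice n m) : R :=
  if c is None then tau else 1.

Definition run_time (R : realType) (n m : nat) (tau : R)
    (c : nat -> dvr_choice n m) (K : nat) : R :=
  \sum_(t < K) step_time tau (c t).

(* K is the first number of iterations at which the bound C0 * rate ^+ K
   is at most eps. *)
Definition is_iteration_count (R : realType) (C0 rate eps : R) (K : nat) :
    Prop :=
  C0 * rate ^+ K <= eps /\ (forall k, C0 * rate ^+ k <= eps -> (K <= k)%N).

(* Main.v *)
Require Import Defs.
From HB Require Import structures.
From mathcomp Require Import all_boot all_order all_algebra.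
From mathcomp Require Import mxtens.
From mathcomp Require Import all_classical all_reals all_analysis.
From mathcomp Require Import ring lra.
From mathcomp Require Import measurable_realfun complex spectral.

Set Implicit Arguments.
Unset Strict Implicit.
Unset Printing Implicit Defensive.
Import Order.TTheory GRing.Theory Num.Theory.
Import numFieldNormedType.Exports.

Local Open Scope classical_set_scope.
Local Open Scope ring_scope.

(** The iteration of DVR keeps, at every node i, the identity
    y_i = sigma_i theta_i + sum_j grad f_ij(z_ij), where y = W w is the image of
    the dual variables of the communication edges: a communication step moves w by
    a multiple of theta, a computation step leaves y unchanged
    ([dual_consistent_step]). At the optimum, stationarity of the objective says
    that the rows of y sum to zero, so y is in the range of W because the graph is
    connected ([gossip_range]).

    The proof exhibits a function V of the state ([lyapunov]) whose conditional
    expectation is multiplied by at most 1 - alpha eta / 2 at each step and which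
    dominates the error. It adds up half the squared distance of the edge variables
    to their optimum and, with weight 1 / alpha, the divergences
    <grad f_ij(z_ij) - grad f_ij(theta_star), z_ij - theta_star> and the weighted
    primal error sum_i sigma_i |theta_i - theta_star|^2 / 2. The expected decrease
    is the sum of two contributions. In a communication step
    ([lyapunov_comm_step]), the first order term is minus the inner product of
    y - y_star with theta - theta_star and the second order terms are absorbed
    thanks to eta lambda_max(A^T Sigma A) <= p_comm. In a computation step, the smoothness and convexity of
    f_ij show that an update with step s lowers the energy of the node by s times the
    divergence of the sampled component, up to s times the inner product of
    grad f_ij(z_ij) - grad f_ij(theta_star) with theta_i - theta_star
    ([computation_step_decrease]). By the identity above these cross terms cancel in
    expectation, which leaves a decrease proportional to the primal error and to the
    divergences ([lyapunov_drift]).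

    These two quantities control the missing one, the distance of the edge
    variables: its square is at most 1 / lambda_min^+(A^T D_M^-1 A) times the
    squared norm of y - y_star weighted by D_M^-1 ([edge_gram_lower]), which
    Cauchy-Schwarz bounds by the primal error and the divergences
    ([node_dual_bound]). The projectors
    P_ij enter there, because gradient differences of f_ij are orthogonal to the
    common kernel of its Hessians ([grad_diff_orthogonal]).

    For the time, put r = kappa_comm / gamma and M = m + kappa_s. The prescribed
    parameters amount to p_comm = r / (r + M) ([comm_probabilityE]) and
    alpha eta >= 1 / (r + M) ([step_size_lower]), while a step lasts (M + tau r) / (r + M) on average; hence
    log(1 / eps) / (alpha eta) iterations take of the order of
    (M + tau r) log(1 / eps) ([expected_time_bound]). *)

(** * Spectral bounds for real symmetric matrices *)

Section Spectral.
Variables (R : realType) (k : nat).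
Implicit Types (M : 'M[R]_k).

Lemma mxtrace_gram (T : comPzRingType) p q (X Y : 'M[T]_(p, q)) :
  \tr (X^T *m Y) = \sum_i \sum_j X i j * Y i j.
Proof.
rewrite exchange_big; apply: eq_bigr => j _; rewrite mxE.
by apply: eq_bigr => i _; rewrite !mxE.
Qed.

(** Substitute for an orthonormal eigenbasis, uniform in the matrix [X] it is
    applied to: [e] lists the eigenvalues of [M] and [wt p X i] is the squared
    length, summed over the columns of [X], of the component along the i-th
    eigenvector.
    The basis itself comes from the complex spectral theorem, so it is complex
    and only these real squared lengths are exported. *)
Lemma eigen_expansion M : M^T = M ->
  exists2 e : 'I_k -> R, (forall i, eigenvalue M (e i)) &
  exists wt : forall p : nat, 'M[R]_(k, p) -> 'I_k -> R,
  [/\ forall p (X : 'M[R]_(k, p)) i, 0 <= wt p X i,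
      forall p (X : 'M[R]_(k, p)), \tr (X^T *m X) = \sum_i wt p X i,
      forall p (X : 'M[R]_(k, p)), \tr (X^T *m (M *m X)) = \sum_i e i * wt p X i &
      forall p (X : 'M[R]_(k, p)) i, wt p (M *m X) i = e i ^+ 2 * wt p X i].
Proof.
move=> Msym.
pose C : numClosedFieldType := (R[i])%C.
pose f : {rmorphism R -> C} := real_complex R.
have fconj x : Num.conj (f x) = f x by apply/CrealP; rewrite complex_real.
pose toC p q (X : 'M[R]_(p, q)) : 'M[C]_(p, q) := map_mx f X.
have toC_real p q (X : 'M[R]_(p, q)) : map_mx Num.conj (toC p q X) = toC p q X.
  by apply/matrixP => i j; rewrite !mxE fconj.
have MCs : toC k k M \is symmetricmx.
  by apply/is_hermitianmxP; rewrite expr0 scale1r map_mx_id // /toC map_trmx Msym.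
have MCr : toC k k M \is a mxOver Num.real.
  by apply/mxOverP => i j; rewrite mxE; apply/CrealP.
have MCh := realsym_hermsym MCs MCr.
have MCn := symmetric_normalmx MCs MCr.
pose P := spectralmx (toC k k M); pose D := spectral_diag (toC k k M).
have MCE : toC k k M = invmx P *m diag_mx D *m P by apply/orthomx_spectralP.
have Pu : P \is unitarymx := spectral_unitarymx _.
have Punit : P \in unitmx := spectral_unit _.
have PP : (map_mx Num.conj P^T) *m P = 1%:M by rewrite -invmx_unitary // mulVmx.
pose e i := complex.Re (D 0 i).
(* M is hermitian over the complex numbers, hence its spectrum is real. *)
have De i : D 0 i = f (e i).
  rewrite /f /= RRe_real //.
  by have /mxOverP := hermitian_spectral_diag_real MCh; apply.
have PM : P *m toC k k M = diag_mx D *m P by rewrite MCE !mulmxA mulmxV // mul1mx.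
exists e.
  move=> i; rewrite -(eigenvalue_map f) -De; apply/eigenvalueP.
  exists (row i P).
    by rewrite -row_mul PM row_mul row_diag_mx -scalemxAl -rowE.
  apply/eqP => Pi0; have := congr1 (mulmx^~ (invmx P)) Pi0.
  rewrite -row_mul mulmxV // mul0mx => /rowP/(_ i).
  by rewrite !mxE eqxx; apply/eqP/oner_neq0.
pose Y p (X : 'M[R]_(k, p)) := P *m toC k p X.
pose wt p (X : 'M[R]_(k, p)) i := complex.Re (\sum_j Y p X i j * Num.conj (Y p X i j)).
have wtE p (X : 'M[R]_(k, p)) i : f (wt p X i) = \sum_j Y p X i j * Num.conj (Y p X i j).
  by rewrite /f /= RRe_real // ger0_real // sumr_ge0 // => j _; apply: mul_conjC_ge0.
have fge0 x : (0 <= f x) = (0 <= x) by rewrite /f /= ler0c.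
have trY p (X : 'M[R]_(k, p)) (Z : 'M[C]_(k, p)) :
  \tr ((map_mx f X)^T *m Z) = \sum_i \sum_j Num.conj (Y p X i j) * (P *m Z) i j.
  have -> : (map_mx f X)^T = map_mx Num.conj (Y p X)^T *m P.
    by rewrite /Y trmx_mul map_mxM -mulmxA PP mulmx1 -map_trmx toC_real.
  rewrite -mulmxA -map_trmx mxtrace_gram.
  by apply: eq_bigr => i _; apply: eq_bigr => j _; rewrite mxE.
have YM p (X : 'M[R]_(k, p)) i j : (P *m (toC k k M *m toC k p X)) i j = f (e i) * Y p X i j.
  by rewrite mulmxA PM -mulmxA -/(Y p X) mul_diag_mx mxE De.
exists wt; split=> p X.
- by move=> i; rewrite -fge0 wtE sumr_ge0 // => j _; apply: mul_conjC_ge0.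
- apply: (fmorph_inj f); rewrite -(trace_map_mx f) rmorph_sum map_mxM -map_trmx trY.
  by apply: eq_bigr => i _; rewrite wtE; apply: eq_bigr => j _; rewrite mulrC.
- apply: (fmorph_inj f); rewrite -(trace_map_mx f) rmorph_sum !map_mxM -map_trmx trY.
  apply: eq_bigr => i _; rewrite rmorphM wtE mulr_sumr.
  by apply: eq_bigr => j _; rewrite YM; ring.
- move=> i; apply: (fmorph_inj f); rewrite rmorphM rmorphXn !wtE mulr_sumr.
  apply: eq_bigr => j _.
  have cM : Num.conj (f (e i) * Y p X i j) = f (e i) * Num.conj (Y p X i j).
    by rewrite [LHS]rmorphM; congr (_ * _); apply: fconj.
  have YE : Y p (M *m X) i j = f (e i) * Y p X i j by rewrite {1}/Y /toC map_mxM YM.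
  by rewrite !YE cM; ring.
Qed.

End Spectral.

Section Rayleigh.
Variables (R : realType) (k : nat).
Implicit Types (M : 'M[R]_k).

Lemma mxtrace_gram_ge0 p q (X : 'M[R]_(p, q)) : 0 <= \tr (X^T *m X).
Proof.
rewrite mxtrace_gram; apply: sumr_ge0 => i _; apply: sumr_ge0 => j _.
by rewrite -expr2 sqr_ge0.
Qed.

Lemma mxtrace_gram_eq0 p q (X : 'M[R]_(p, q)) : (\tr (X^T *m X) == 0) = (X == 0).
Proof.
apply/eqP/eqP => [|->]; last by rewrite mulmx0 mxtrace0.
rewrite mxtrace_gram => X0; apply/matrixP => i j; rewrite mxE.
apply/eqP; rewrite -sqrf_eq0 eq_le sqr_ge0 andbT -X0 (bigD1 i) //= (bigD1 j) //=.
rewrite -addrA expr2 lerDl addr_ge0 // sumr_ge0 // => i' _.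
  by rewrite -expr2 sqr_ge0.
by apply: sumr_ge0 => j' _; rewrite -expr2 sqr_ge0.
Qed.

Lemma mxtrace_gram_gt0 p q (X : 'M[R]_(p, q)) : X != 0 -> 0 < \tr (X^T *m X).
Proof. by move=> X0; rewrite lt_def mxtrace_gram_eq0 X0 mxtrace_gram_ge0. Qed.

Lemma sym_eigenvector M a : M^T = M -> eigenvalue M a ->
  exists2 v : 'cV[R]_k, v != 0 & M *m v = a *: v.
Proof.
move=> Ms /eigenvalueP[v vM v0]; exists v^T.
  by apply: contra_neq v0 => vT; rewrite -[v]trmxK vT trmx0.
by rewrite -{1}Ms -trmx_mul vM linearZ.
Qed.

(** Without it the supremum defining [lambda_max] would be a junk value. *)
Lemma eigenvalue_has_ubound M : M^T = M -> has_ubound [set a | eigenvalue M a].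
Proof.
move=> Ms; have [e ev [wt [wt_ge0 trX trMX _]]] := eigen_expansion Ms.
exists (\sum_i `|e i|) => a /(sym_eigenvector Ms)[v v0 Mv].
rewrite -(ler_pM2r (mxtrace_gram_gt0 v0)).
have -> : a * \tr (v^T *m v) = \tr (v^T *m (M *m v)).
  by rewrite Mv -scalemxAr mxtraceZ.
rewrite trX trMX mulr_sumr; apply: ler_sum => i _; apply: ler_wpM2r => //.
rewrite (bigD1 i) //= (le_trans (ler_norm _)) // lerDl.
by apply: sumr_ge0.
Qed.

Lemma eigenvalue_le_lambda_max M a : M^T = M -> eigenvalue M a -> a <= lambda_max M.
Proof. by move=> Ms ea; apply: (ub_le_sup (eigenvalue_has_ubound Ms)). Qed.

Lemma rayleigh_le_lambda_max M p (X : 'M[R]_(k, p)) : M^T = M ->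
  \tr (X^T *m (M *m X)) <= lambda_max M * \tr (X^T *m X).
Proof.
move=> Ms; have [e ev [wt [wt_ge0 -> -> _]]] := eigen_expansion Ms.
rewrite mulr_sumr; apply: ler_sum => i _; apply: ler_wpM2r => //.
exact: eigenvalue_le_lambda_max.
Qed.

(** Positive semidefiniteness is quantified over matrices [X] rather than
    vectors because the iterates are n x d matrices whose d columns are treated
    simultaneously. *)
Definition psd M := forall p (X : 'M[R]_(k, p)), 0 <= \tr (X^T *m (M *m X)).

Lemma psd_eigenvalue_ge0 M a : M^T = M -> psd M -> eigenvalue M a -> 0 <= a.
Proof.
move=> Ms Mp /(sym_eigenvector Ms)[v v0 Mv].
have := Mp _ v; rewrite Mv -scalemxAr mxtraceZ pmulr_lge0 //.
exact: mxtrace_gram_gt0.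
Qed.

Lemma lambda_max_ge0 M : (0 < k)%N -> M^T = M -> psd M -> 0 <= lambda_max M.
Proof.
move=> k0 Ms Mp; pose X : 'cV[R]_k := const_mx 1.
have X0 : X != 0.
  by apply/eqP => /matrixP/(_ (Ordinal k0) 0); rewrite !mxE => /eqP; rewrite oner_eq0.
rewrite -(pmulr_lge0 _ (mxtrace_gram_gt0 X0)).
exact: le_trans (Mp _ X) (rayleigh_le_lambda_max _ Ms).
Qed.

(** On its range, a positive semidefinite matrix is bounded below by its smallest
    nonzero eigenvalue: the components of [M *m X] along the kernel vanish,
    their weight being multiplied by the square of the eigenvalue 0. *)
Lemma psd_spectral_gap M p (X : 'M[R]_(k, p)) : M^T = M -> psd M ->
  lambda_min_pos M * \tr ((M *m X)^T *m (M *m X))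
    <= \tr ((M *m X)^T *m (M *m (M *m X))).
Proof.
move=> Ms Mp; have [e ev [wt [wt_ge0 trX trMX wtM]]] := eigen_expansion Ms.
rewrite trX trMX mulr_sumr; apply: ler_sum => i _; rewrite wtM [leLHS]mulrA [leRHS]mulrA.
apply: ler_wpM2r => //; have [->|ei0] := eqVneq (e i) 0.
  by rewrite expr0n mulr0 mul0r.
apply: ler_wpM2r; first exact: sqr_ge0.
apply: ge_inf; last by split.
by exists 0 => a [/(psd_eigenvalue_ge0 Ms Mp)].
Qed.

Lemma psd_pos_eigenvalue M : M^T = M -> psd M -> M != 0 ->
  exists2 a, eigenvalue M a & 0 < a.
Proof.
move=> Ms Mp M0; have [e ev [wt [_ trX _ wtM]]] := eigen_expansion Ms.
have [i ei0] : exists i, e i != 0.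
  apply/existsP; rewrite -negb_forall; apply: contraNN M0 => /forallP e0.
  rewrite -[M]mulmx1 -mxtrace_gram_eq0 trX big1 // => i _.
  by rewrite wtM (eqP (e0 i)) expr0n mul0r.
by exists (e i); rewrite // lt_def ei0 (psd_eigenvalue_ge0 Ms Mp).
Qed.

(** A lower bound [dl] of the nonzero entries of the finite list [e] bounds every
    nonzero eigenvalue [a]: summing [e i ^+ 2 >= dl * e i] over the components of
    an eigenvector for [a] gives [a ^+ 2 >= dl * a]. *)
Lemma lambda_min_pos_gt0 M : M^T = M -> psd M -> M != 0 -> 0 < lambda_min_pos M.
Proof.
move=> Ms Mp M0; have [e ev [wt [wt_ge0 trX trMX wtM]]] := eigen_expansion Ms.
have e_ge0 i : 0 <= e i := psd_eigenvalue_ge0 Ms Mp (ev i).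
pose dl := \big[Order.min/1]_(i | e i != 0) e i.
have dl_gt0 : 0 < dl.
  by apply: lt_bigmin => // j ej0; rewrite lt_def ej0 e_ge0.
apply: lt_le_trans dl_gt0 _; apply: lb_le_inf.
  by have [a ea a0] := psd_pos_eigenvalue Ms Mp M0; exists a; rewrite /= gt_eqF.
move=> a [ea a0]; have a_gt0 : 0 < a by rewrite lt_def a0 (psd_eigenvalue_ge0 Ms Mp).
have [v v0 Mv] := sym_eigenvector Ms ea.
rewrite -(ler_pM2r (_ : 0 < a * \tr (v^T *m v))); last first.
  by rewrite mulr_gt0 // mxtrace_gram_gt0.
have -> : a * (a * \tr (v^T *m v)) = \tr ((M *m v)^T *m (M *m v)).
  by rewrite Mv [(a *: v)^T]linearZ /= -scalemxAl -scalemxAr !mxtraceZ.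
have -> : a * \tr (v^T *m v) = \tr (v^T *m (M *m v)).
  by rewrite Mv -scalemxAr mxtraceZ.
rewrite trX trMX mulr_sumr; apply: ler_sum => j _; rewrite wtM mulrA.
apply: ler_wpM2r => //; have [->|ej0] := eqVneq (e j) 0.
  by rewrite mulr0 expr0n.
by rewrite expr2 ler_wpM2r // bigmin_le_cond.
Qed.

Lemma lambda_max_gt0 M : M^T = M -> psd M -> M != 0 -> 0 < lambda_max M.
Proof.
move=> Ms Mp M0; have [a ea a0] := psd_pos_eigenvalue Ms Mp M0.
exact: lt_le_trans a0 (eigenvalue_le_lambda_max Ms ea).
Qed.

End Rayleigh.

Section TensorIdentity.
Variables (R : realType) (k d : nat).

Lemma sum_mxtens (F : 'I_(k * d) -> R) :
  \sum_j F j = \sum_i \sum_c F (mxtens_index (i, c)).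
Proof.
rewrite pair_big (reindex (@mxtens_index k d)) /=.
  by apply: eq_bigr => -[].
by exists (@mxtens_unindex k d) => x _; rewrite ?mxtens_indexK ?mxtens_unindexK.
Qed.

(** An eigenvector of the Kronecker product is reshaped into a k x d matrix, each
    nonzero column of which is an eigenvector of [M]; conversely an eigenvector
    of [M] is padded into column [o]. *)
Lemma eigenvalue_tens1 (M : 'M[R]_k) (a : R) : (0 < d)%N ->
  eigenvalue (M *t (1%:M : 'M[R]_d)) a = eigenvalue M a.
Proof.
move=> d0; pose o := Ordinal d0.
apply/idP/idP => [|/eigenvalueP[v vM v0]].
  move=> /eigenvalueP[v vM v0].
  have [j vj0] : exists j, v 0 j != 0.
    apply/existsP; rewrite -negb_forall; apply: contraNN v0 => /forallP v0.
    by apply/eqP/rowP => j; rewrite mxE; apply/eqP.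
  case: (mxtens_indexP j) vj0 => i c vic.
  apply/eigenvalueP; exists (\row_i' v 0 (mxtens_index (i', c))).
    apply/rowP => l; have /rowP/(_ (mxtens_index (l, c))) := vM.
    rewrite !mxE => <-.
    rewrite sum_mxtens; apply: eq_bigr => i' _; rewrite (bigD1 c) //= tensmxE !mxE eqxx mulr1.
    rewrite big1 ?addr0 // => c' c'c; rewrite tensmxE !mxE (negbTE c'c) !mulr0 //.
  by apply: contraNneq vic => /rowP/(_ i); rewrite !mxE => ->.
pose w : 'rV[R]_(k * d) :=
  \row_j (v 0 (mxtens_unindex j).1 * ((mxtens_unindex j).2 == o)%:R).
have wE i c : w 0 (mxtens_index (i, c)) = v 0 i * (c == o)%:R.
  by rewrite mxE mxtens_indexK.
apply/eigenvalueP; exists w.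
  apply/rowP => j; case: (mxtens_indexP j) => l c; rewrite [in LHS]mxE [in RHS]mxE wE.
  have /rowP/(_ l) := vM; rewrite !mxE mulrA => <-.
  rewrite sum_mxtens mulr_suml; apply: eq_bigr => i' _.
  rewrite (bigD1 c) //= tensmxE wE !mxE eqxx mulr1.
  rewrite big1 ?addr0 1?mulrAC // => c' c'c.
  by rewrite tensmxE !mxE (negbTE c'c) !mulr0.
have [i vi0] : exists i, v 0 i != 0.
  apply/existsP; rewrite -negb_forall; apply: contraNN v0 => /forallP v0.
  by apply/eqP/rowP => j; rewrite mxE; apply/eqP.
apply: contraNneq vi0 => /rowP/(_ (mxtens_index (i, o))).
by rewrite wE mxE eqxx mulr1 => ->.
Qed.

Lemma lambda_max_tens1 (M : 'M[R]_k) : (0 < d)%N ->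
  lambda_max (M *t (1%:M : 'M[R]_d)) = lambda_max M.
Proof.
move=> d0; congr sup; apply/seteqP.
by split => a /=; rewrite eigenvalue_tens1.
Qed.

Lemma lambda_min_pos_tens1 (M : 'M[R]_k) : (0 < d)%N ->
  lambda_min_pos (M *t (1%:M : 'M[R]_d)) = lambda_min_pos M.
Proof.
move=> d0; congr inf; apply/seteqP.
by split => a /=; rewrite eigenvalue_tens1.
Qed.

End TensorIdentity.

(** * The Euclidean inner product *)

Section Dotp.
Variables (R : realType) (d : nat).
Implicit Types u v w : 'rV[R]_d.

Lemma dotpC u v : dotp u v = dotp v u.
Proof. by apply: eq_bigr => k _; rewrite mulrC. Qed.

Lemma dotpDl u v w : dotp (u + v) w = dotp u w + dotp v w.
Proof. by rewrite /dotp -big_split; apply: eq_bigr => k _; rewrite mxE mulrDl. Qed.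

Lemma dotpZl a u v : dotp (a *: u) v = a * dotp u v.
Proof. by rewrite /dotp mulr_sumr; apply: eq_bigr => k _; rewrite mxE mulrA. Qed.

Lemma dotpNl u v : dotp (- u) v = - dotp u v.
Proof. by rewrite -scaleN1r dotpZl mulN1r. Qed.

Lemma dotpBl u v w : dotp (u - v) w = dotp u w - dotp v w.
Proof. by rewrite dotpDl dotpNl. Qed.

Lemma dotpDr u v w : dotp w (u + v) = dotp w u + dotp w v.
Proof. by rewrite dotpC dotpDl !(dotpC w). Qed.

Lemma dotpZr a u v : dotp v (a *: u) = a * dotp v u.
Proof. by rewrite dotpC dotpZl dotpC. Qed.

Lemma dotpNr u v : dotp v (- u) = - dotp v u.
Proof. by rewrite dotpC dotpNl dotpC. Qed.

Lemma dotpBr u v w : dotp w (u - v) = dotp w u - dotp w v.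
Proof. by rewrite dotpDr dotpNr. Qed.

Lemma dot0p u : dotp 0 u = 0.
Proof. by rewrite -(scale0r 0) dotpZl mul0r. Qed.

Lemma dotp0 u : dotp u 0 = 0.
Proof. by rewrite dotpC dot0p. Qed.

Lemma dotp_suml (I : Type) (r : seq I) (P : pred I) (F : I -> 'rV[R]_d) w :
  dotp (\sum_(i <- r | P i) F i) w = \sum_(i <- r | P i) dotp (F i) w.
Proof.
by apply: (big_morph (fun u => dotp u w)) => [u v|]; [apply: dotpDl | apply: dot0p].
Qed.

Lemma dotp_sumr (I : Type) (r : seq I) (P : pred I) (F : I -> 'rV[R]_d) w :
  dotp w (\sum_(i <- r | P i) F i) = \sum_(i <- r | P i) dotp w (F i).
Proof. by rewrite dotpC dotp_suml; apply: eq_bigr => i _; apply: dotpC. Qed.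

Lemma dotp_ge0 u : 0 <= dotp u u.
Proof. by apply: sumr_ge0 => k _; rewrite -expr2 sqr_ge0. Qed.

Lemma dotp_eq0 u : (dotp u u == 0) = (u == 0).
Proof.
apply/eqP/eqP => [u0|->]; last exact: dot0p.
apply/rowP => k; rewrite mxE; apply/eqP; rewrite -sqrf_eq0 eq_le sqr_ge0 andbT.
rewrite -u0 /dotp (bigD1 k) //= expr2 lerDl.
by apply: sumr_ge0 => l _; rewrite -expr2 sqr_ge0.
Qed.

Lemma enorm_sqr u : enorm u ^+ 2 = dotp u u.
Proof. by rewrite /enorm sqr_sqrtr // dotp_ge0. Qed.

Lemma enorm_ge0 u : 0 <= enorm u.
Proof. exact: sqrtr_ge0. Qed.

Lemma dotp_young (t : R) u v : 0 < t ->
  dotp u v <= (t * dotp u u + t^-1 * dotp v v) / 2.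
Proof.
move=> t0; have := dotp_ge0 (t *: u - v).
rewrite dotpBl !dotpBr !dotpZl !dotpZr (dotpC v u) => h.
rewrite ler_pdivlMr // -(ler_pM2l t0).
have -> : t * (t * dotp u u + t^-1 * dotp v v) = t * (t * dotp u u) + dotp v v.
  by rewrite mulrDr mulVKf ?gt_eqF.
lra.
Qed.

Lemma dotp_mulmx_sym (P : 'M[R]_d) u v : P^T = P -> dotp (u *m P) v = dotp u (v *m P).
Proof.
move=> Ps; have dotpE a b : dotp a b = (a *m b^T) 0 0 :> R.
  by rewrite mxE; apply: eq_bigr => k _; rewrite mxE.
by rewrite !dotpE trmx_mul Ps mulmxA.
Qed.

Lemma mxtrace_gram_rows n (X Y : 'M[R]_(n, d)) :
  \tr (X^T *m Y) = \sum_i dotp (row i X) (row i Y).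
Proof.
rewrite mxtrace_gram; apply: eq_bigr => i _.
by apply: eq_bigr => j _; rewrite !mxE.
Qed.

End Dotp.

(** * The gossip matrix of a connected graph *)

Section LinearRange.
Variable (R : realType).

(** The range of a symmetric matrix is the orthogonal complement of its kernel;
    this replaces the pseudo-inverse of the gossip matrix in the analysis. *)
Lemma sym_range k p (N : 'M[R]_k) (Y : 'M[R]_(k, p)) : N^T = N ->
  (forall V : 'M[R]_k, N *m V = 0 -> Y^T *m V = 0) -> exists Z, Y = N *m Z.
Proof.
move=> Ns NY; have /submxP[D YD] : (Y^T <= N)%MS.
  by rewrite submxE; apply/eqP; apply: NY; apply: mulmx_coker.
by exists D^T; rewrite -[Y]trmxK YD trmx_mul Ns.
Qed.

End LinearRange.

Section Gossip.
Variables (R : realType) (n E : nat) (src dst : 'I_E -> 'I_n) (mu : 'I_E -> R).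

Definition incidence : 'M[R]_(n, E) :=
  \matrix_(i < n, e < E) (mu e * ((i == src e)%:R - (i == dst e)%:R)).

Local Notation B := incidence.

(** The Gram matrix on edges with node weights [s]. The two matrices whose
    eigenvalues set the step sizes are, up to a Kronecker factor, its instances
    at the inverses of sigma and of the diagonal of D_M. *)
Definition edge_gram (s : 'I_n -> R) : 'M[R]_E :=
  B^T *m diag_mx (\row_(i < n) s i) *m B.

Lemma edge_gram_sym s : (edge_gram s)^T = edge_gram s.
Proof. by rewrite /edge_gram !trmx_mul trmxK tr_diag_mx mulmxA. Qed.

Lemma edge_gram_quadratic s p (X : 'M[R]_(E, p)) :
  \tr (X^T *m (edge_gram s *m X))
  = \sum_i s i * dotp (row i (B *m X)) (row i (B *m X)).
Proof.
have -> : X^T *m (edge_gram s *m X)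
   = (B *m X)^T *m (diag_mx (\row_(i < n) s i) *m (B *m X)).
  by rewrite /edge_gram trmx_mul !mulmxA.
rewrite mxtrace_gram; apply: eq_bigr => i _; rewrite mulr_sumr.
by apply: eq_bigr => j _; rewrite mul_diag_mx !mxE mulrCA.
Qed.

Lemma edge_gram_psd s : (forall i, 0 <= s i) -> psd (edge_gram s).
Proof.
move=> s0 p X; rewrite edge_gram_quadratic; apply: sumr_ge0 => i _.
by rewrite mulr_ge0 // dotp_ge0.
Qed.

Lemma edge_gram_ker s p (X : 'M[R]_(E, p)) : (forall i, 0 < s i) ->
  edge_gram s *m X = 0 -> B *m X = 0.
Proof.
move=> s0 X0; have /esym := edge_gram_quadratic s X.
rewrite X0 mulmx0 mxtrace0 => /psumr_eq0P BX0; apply/row_matrixP => i.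
apply/eqP; rewrite row0 -dotp_eq0.
have /eqP := BX0 (fun j _ => mulr_ge0 (ltW (s0 j)) (dotp_ge0 _)) i isT.
by rewrite mulf_eq0 gt_eqF.
Qed.

Lemma edge_gram_neq0 s : (forall i, 0 < s i) -> B != 0 -> edge_gram s != 0.
Proof.
move=> s0; apply: contraNneq => s1; rewrite -[B]mulmx1; apply/eqP.
by apply: (edge_gram_ker s0); rewrite s1 mul0mx.
Qed.

(** [B^T *m X] is orthogonal to the kernel of [B], which is also the kernel of
    the weighted Gram matrix, so it lies in the range of the latter and the
    spectral gap applies to it. *)
Lemma edge_gram_lower s p (X : 'M[R]_(n, p)) : (forall i, 0 < s i) ->
  lambda_min_pos (edge_gram s) * \tr (X^T *m (B *m B^T *m X))
  <= \sum_i s i * dotp (row i (B *m B^T *m X)) (row i (B *m B^T *m X)).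
Proof.
move=> s0; have [V|Z ZE] := @sym_range R E p (edge_gram s) (B^T *m X) (edge_gram_sym s).
  by move=> /(edge_gram_ker s0) BV0; rewrite trmx_mul trmxK -mulmxA BV0 mulmx0.
have := psd_spectral_gap Z (edge_gram_sym s) (edge_gram_psd (fun i => ltW (s0 i))).
rewrite -ZE edge_gram_quadratic trmx_mul trmxK.
by rewrite -!mulmxA.
Qed.

Lemma edge_gram_upper s p (Y : 'M[R]_(E, p)) :
  \sum_i s i * dotp (row i (B *m Y)) (row i (B *m Y))
  <= lambda_max (edge_gram s) * \tr (Y^T *m Y).
Proof. by rewrite -edge_gram_quadratic rayleigh_le_lambda_max // edge_gram_sym. Qed.

(** With [Y = B^T *m X], Young's inequality bounds the inner product of [X] and
    [B *m Y], which is the squared length of [Y], by half of the right-hand side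
    plus half of that squared length. *)
Lemma gossip_upper (sigma : 'I_n -> R) p (X : 'M[R]_(n, p)) :
  (forall i, 0 < sigma i) -> B != 0 ->
  \tr (X^T *m (B *m B^T *m X))
  <= lambda_max (edge_gram (fun i => (sigma i)^-1))
       * \sum_i sigma i * dotp (row i X) (row i X).
Proof.
move=> s0 B0; set Lam := lambda_max _; have si0 i : 0 < (sigma i)^-1 by rewrite invr_gt0.
have Lam_gt0 : 0 < Lam.
  apply: lambda_max_gt0; [exact: edge_gram_sym| |exact: edge_gram_neq0].
  by apply: edge_gram_psd => i; apply: ltW.
have trE : \tr (X^T *m (B *m B^T *m X)) = \tr ((B^T *m X)^T *m (B^T *m X)).
  by rewrite trmx_mul trmxK -!mulmxA.
have := edge_gram_upper (fun i => (sigma i)^-1) (B^T *m X).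
rewrite -trE -/Lam mulmxA => up.
have young i : dotp (row i X) (row i (B *m B^T *m X)) <=
    (Lam * sigma i * dotp (row i X) (row i X)
     + Lam^-1 * ((sigma i)^-1 * dotp (row i (B *m B^T *m X)) (row i (B *m B^T *m X)))) / 2.
  have := @dotp_young R p (Lam * sigma i) (row i X) (row i (B *m B^T *m X)).
  by rewrite invfM -!mulrA; apply; rewrite mulr_gt0.
have := ler_sum _ (fun i (_ : true) => young i) : _ <= \sum_(i | true) _.
rewrite -mxtrace_gram_rows -mulr_suml big_split /= -!mulr_sumr => h.
have h2 : Lam^-1 * (\sum_i (sigma i)^-1 * dotp (row i (B *m B^T *m X)) (row i (B *m B^T *m X)))
    <= \tr (X^T *m (B *m B^T *m X)).
  by rewrite mulrC ler_pdivrMr // mulrC.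
rewrite mulr_sumr; under eq_bigr do rewrite mulrA.
lra.
Qed.

Variable (adj : rel 'I_n).
Hypotheses (n_gt1 : (1 < n)%N) (adjC : connected_graph adj)
  (edges : edge_orientation adj src dst) (mu_gt0 : forall e, 0 < mu e).

(** Connectedness enters here only: a vector annihilated by the transposed
    incidence matrix takes equal values at the two ends of every edge, hence at
    any two nodes. *)
Lemma incidence_ker p (X : 'M[R]_(n, p)) : B^T *m X = 0 ->
  forall i k, row i X = row k X.
Proof.
move=> BX0 i k; have [sym irr conn] := adjC.
have stepE a b : adj a b -> row a X = row b X.
  move=> /(edges.2 a b)[e [ab _]].
  have sd : row (src e) X = row (dst e) X.
    apply/rowP => c; have /matrixP/(_ e c) := BX0; rewrite !mxE.
    have sdne : src e != dst e.
      by apply: contraTneq (edges.1 e) => ->; rewrite irr.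
    rewrite (bigD1 (src e)) //= (bigD1 (dst e)) 1?eq_sym //= !mxE !eqxx.
    rewrite (negbTE sdne) [dst e == _]eq_sym (negbTE sdne) big1 => [|l /andP[l1 l2]].
      rewrite subr0 sub0r mulr1 mulrN1 addr0 mulNr -mulrBr => /eqP.
      by rewrite mulf_eq0 gt_eqF //= subr_eq0 => /eqP.
    by rewrite !mxE (negbTE l1) (negbTE l2) subrr mulr0 mul0r.
  by case: ab => -[<- <-].
have /connectP[q] := conn i k.
elim: q i => [i _ -> //|a q IH i /= /andP[ia aq] kE].
by rewrite (stepE _ _ ia); apply: IH.
Qed.

Lemma incidence_neq0 : B != 0.
Proof.
apply/eqP => B0; pose i0 := Ordinal (ltnW n_gt1); pose i1 := Ordinal n_gt1.
have := @incidence_ker 1 (delta_mx i0 0); rewrite B0 trmx0 mul0mx => /(_ erefl i0 i1).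
by move=> /rowP/(_ 0); rewrite !mxE !eqxx /= => /eqP; rewrite oner_eq0.
Qed.

Lemma gossip_range p (Y : 'M[R]_(n, p)) : \sum_i row i Y = 0 ->
  exists Z, Y = B *m B^T *m Z.
Proof.
move=> Y0; apply: sym_range; first by rewrite trmx_mul trmxK.
move=> V WV0; have BV : B^T *m V = 0.
  apply/eqP; rewrite -mxtrace_gram_eq0 trmx_mul trmxK -mulmxA [B *m _]mulmxA WV0.
  by rewrite mulmx0 mxtrace0.
have Vc := incidence_ker BV; pose i0 := Ordinal (ltnW n_gt1).
apply/matrixP => a b; rewrite !mxE.
rewrite (eq_bigr (fun i => row i Y 0 a * V i0 b)); last first.
  by move=> i _; have /rowP/(_ b) := Vc i i0; rewrite !mxE => ->.
by rewrite -mulr_suml -summxE Y0 mxE mul0r.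
Qed.

Lemma gossip_row_sum p (X : 'M[R]_(E, p)) : \sum_i row i (B *m X) = 0.
Proof.
apply/rowP => c; rewrite summxE mxE.
under eq_bigr do rewrite !mxE.
rewrite exchange_big big1 // => e _; rewrite -mulr_suml.
have -> : \sum_i B i e = 0; last by rewrite mul0r.
under eq_bigr do rewrite mxE.
rewrite -mulr_sumr sumrB (bigD1 (src e)) // eqxx big1 => [|i /negbTE-> //].
rewrite (bigD1 (dst e)) // eqxx big1 => [|i /negbTE-> //].
by rewrite subrr mulr0.
Qed.

End Gossip.

(** * Smooth convex functions and Bregman divergences *)

Section LineDerivative.
Variables (R : realType) (d : nat).
Implicit Types (f : 'rV[R]_d -> R) (x v w : 'rV[R]_d).

Lemma derive_grad f x v : differentiable f x -> 'D_v f x = dotp (grad f x) v.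
Proof.
move=> df; rewrite deriveE // [v in LHS]row_sum_delta linear_sum.
by apply: eq_bigr => k _; rewrite linearZ /= mxE deriveE // mulrC.
Qed.

Lemma is_derive_line f x v (t : R) : differentiable f (x + t *: v) ->
  is_derive t 1 (fun t => f (x + t *: v)) ('D_v f (x + t *: v)).
Proof.
move=> df; have dfv : derivable f (x + t *: v) v by apply: diff_derivable.
have quotE : (fun h => h^-1 *: (((fun s => f (x + s *: v)) \o shift t) (h *: 1)
                                - f (x + t *: v)))
  = (fun h => h^-1 *: ((f \o shift (x + t *: v)) (h *: v) - f (x + t *: v))).
  apply/funext => h /=; congr (_ *: (f _ - _)).
  by rewrite [h *: 1]mulr1 scalerDl addrCA.
by split; [rewrite /derivable quotE | rewrite /derive quotE].
Qed.

Lemma is_derive_line_grad f x v (t : R) : (forall y, differentiable f y) ->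
  is_derive t 1 (fun t => f (x + t *: v)) (dotp (grad f (x + t *: v)) v).
Proof. by move=> df; rewrite -derive_grad //; apply: is_derive_line. Qed.

Definition bregman f x y := f x - f y - dotp (grad f y) (x - y).

End LineDerivative.

Section SmoothConvex.
Variables (R : realType) (d : nat) (L : R) (f : 'rV[R]_d -> R).
Implicit Types (x y v w : 'rV[R]_d).
Hypotheses (f_diff : forall x, differentiable f x) (L_ge0 : 0 <= L)
  (f_smooth : smooth L f).

Lemma smooth_sqr x y :
  dotp (grad f x - grad f y) (grad f x - grad f y) <= L ^+ 2 * dotp (x - y) (x - y).
Proof.
rewrite -!enorm_sqr -exprMn ler_sqr ?nnegrE ?enorm_ge0 //.
by rewrite mulr_ge0 // enorm_ge0.
Qed.

Lemma smooth_dotp x v t : 0 < t ->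
  dotp (grad f (x + t *: v) - grad f x) v <= L * t * dotp v v.
Proof.
move=> t0; set h := grad f _ - _.
have := smooth_sqr (x + t *: v) x; rewrite -/h [x + _]addrC addrK dotpZl dotpZr => hle.
have [L0|Ln0] := eqVneq L 0.
  move: hle; rewrite L0 expr0n /= !mul0r => h0.
  suff -> : h = 0 by rewrite dot0p.
  by apply/eqP; rewrite -dotp_eq0 eq_le h0 dotp_ge0.
have Lt : 0 < L * t by rewrite mulr_gt0 // lt_def Ln0.
have Lt0 : 0 < (L * t)^-1 by rewrite invr_gt0.
apply: (le_trans (dotp_young h v Lt0)); rewrite invrK ler_pdivrMr //.
have : (L * t)^-1 * dotp h h <= L * t * dotp v v.
  rewrite mulrC ler_pdivrMr // (le_trans hle) //.
  by rewrite le_eqVlt; apply/orP; left; apply/eqP; ring.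
lra.
Qed.

(** The mean value theorem on the segment from [y] to [x], applied to [f] minus
    its quadratic upper model. *)
Lemma bregman_upper x y : bregman f x y <= L / 2 * dotp (x - y) (x - y).
Proof.
pose v : 'rV[R]_d := x - y.
pose g t := f (y + t *: v) - t * dotp (grad f y) v - t ^+ 2 * (L / 2 * dotp v v).
pose dg t := dotp (grad f (y + t *: v)) v - dotp (grad f y) v - L * t * dotp v v.
have gd (t : R) : is_derive t 1 g (dg t).
  have -> : g = (fun t => f (y + t *: v)) - (dotp (grad f y) v \*: (@id R))
      - ((L / 2 * dotp v v) \*: ((@id R) ^+ 2)).
    apply/funext => s; rewrite /g !fctE /= /GRing.scale /=; ring.
  have := is_derive_line_grad y v t f_diff => h.
  by apply: is_derive_eq; rewrite /dg /GRing.scale /=; field.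
have [c] : exists2 c, c \in `]0, 1[%R & g 1 - g 0 = dg c * (1 - 0).
  apply: (@MVT R g dg 0 1 ltr01).
  by apply: derivable_within_continuous => s _; have [] := gd s.
rewrite in_itv /= => /andP[c0 _].
have := smooth_dotp y v c0; rewrite dotpBl => cs.
have yv : y + v = x by rewrite /v addrC subrK.
rewrite /g /dg scale1r scale0r addr0 yv expr0n expr1n /bregman -/v.
rewrite subr0 mulr1 /= => gE; lra.
Qed.

Hypothesis (f_conv : convex_function [set: 'rV[R]_d] f).

Lemma convex_line x y t : 0 <= t -> t <= 1 ->
  f (y + t *: (x - y)) <= f y + t * (f x - f y).
Proof.
move=> t0 t1; have /= := f_conv (Itv01 t0 t1) (in_setT x) (in_setT y).
have -> : y + t *: (x - y) = t *: x + (1 - t) *: y.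
  by rewrite scalerBl scale1r scalerBr [RHS]addrCA addrA.
move=> h; apply: (le_trans h); rewrite convRE /= /unstable.onem; lra.
Qed.

Lemma bregman_ge0 x y : 0 <= bregman f x y.
Proof.
rewrite /bregman subr_ge0; pose v : 'rV[R]_d := x - y.
have [dl dlE] := is_derive_line_grad y v 0 f_diff.
move: dl; rewrite /derivable => /cvgP; rewrite -/(derive _ _ _) dlE.
move=> /cvg_dnbhs_at_right; rewrite scale0r addr0 => dl.
apply: (cvgr_to_le dl); near=> h.
have h0 : 0 < h by near: h; apply: nbhs_right_gt.
have h1 : h <= 1 by apply: ltW; near: h; apply: nbhs_right_lt.
rewrite /= addr0 [h *: 1]mulr1 /GRing.scale /= mulrC ler_pdivrMr //.
by have := convex_line x y (ltW h0) h1; rewrite -/v; lra.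
Unshelve. all: by end_near. Qed.

(** Compare [f] at the point reached from [x] by a gradient step for the convex
    function [f - <grad f y, .>], of which [y] is a minimizer. *)
Lemma cocoercive x y :
  dotp (grad f x - grad f y) (grad f x - grad f y) <= 2 * L * bregman f x y.
Proof.
set h := grad f x - grad f y.
have [L0|Ln0] := eqVneq L 0.
  by have := smooth_sqr x y; rewrite L0 expr0n mulr0 !mul0r.
have L_gt0 : 0 < L by rewrite lt_def Ln0.
have := bregman_ge0 (x - L^-1 *: h) y; have := bregman_upper (x - L^-1 *: h) x.
rewrite /bregman [x - _ - x]addrAC subrr sub0r !(dotpNl, dotpNr, dotpZl, dotpZr).
have -> : x - L^-1 *: h - y = (x - y) - L^-1 *: h by rewrite addrAC.
rewrite [dotp _ (x - y - _)]dotpBr dotpZr => h1 h2.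
have hE : dotp (grad f x) h - dotp (grad f y) h = dotp h h by rewrite -dotpBl.
have : 0 <= f x - f y - dotp (grad f y) (x - y) - L^-1 * dotp h h
            + L / 2 * - - (L^-1 * (L^-1 * dotp h h)).
  rewrite -{1}hE; lra.
have -> : L / 2 * - - (L^-1 * (L^-1 * dotp h h)) = L^-1 * dotp h h / 2 by field.
move=> h3; have : L^-1 * dotp h h <= 2 * (f x - f y - dotp (grad f y) (x - y)) by lra.
by rewrite mulrC ler_pdivrMr // => h4; rewrite (le_trans h4) // mulrAC.
Qed.

Hypothesis f_diff2 : forall x, differentiable (grad f) x.

Lemma kernel_grad_const w : common_hessian_kernel f w ->
  forall x t, grad f (x + t *: w) = grad f x.
Proof.
move=> wK x t; apply/rowP => k.
pose G x := grad f x 0 k.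
have dG y : differentiable G y.
  apply: (@differentiable_comp _ _ _ _ (grad f) (fun M : 'rV[R]_d => M 0 k)) => //.
  exact: differentiable_coord.
have DG y : 'D_w G y = 0.
  rewrite deriveE // /G (_ : (fun x => _) = (fun M : 'rV[R]_d => M 0 k) \o grad f) //.
  rewrite diff_comp //; last exact: differentiable_coord.
  have := wK y I; rewrite /= -deriveEjacobian // deriveE // => D0.
  by rewrite /= D0 linear0.
rewrite -[x in RHS]addr0 -(scale0r w).
apply: (@is_derive_0_is_cst R (fun t => G (x + t *: w)) t 0) => s.
by rewrite -(DG (x + s *: w)); apply: is_derive_line.
Qed.

Lemma affine_along_kernel w : common_hessian_kernel f w ->
  forall x t, f (x + t *: w) = f x + t * dotp (grad f x) w.
Proof.
move=> wK x t.
pose g t := f (x + t *: w) - t * dotp (grad f x) w.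
have g0 (s : R) : is_derive s 1 g 0.
  have -> : g = (fun t => f (x + t *: w)) - (dotp (grad f x) w \*: (@id R)).
    by apply/funext => r; rewrite /g !fctE /= /GRing.scale /= mulrC.
  have := is_derive_line_grad x w s f_diff => h.
  apply: is_derive_eq; rewrite kernel_grad_const // /GRing.scale /=; ring.
have := is_derive_0_is_cst t 0 g0; rewrite /g scale0r addr0 mul0r; lra.
Qed.

(** Along a direction [w] of the common kernel of the Hessians the function is
    affine, so that the Bregman divergence of [x + t w] from [y + t w] is affine
    in [t]; being nonnegative for all [t] it must have zero slope, and this slope
    is the inner product of the gradient difference with [w]. *)
Lemma grad_diff_orthogonal x y :
  orthogonal_compl (common_hessian_kernel f) (grad f x - grad f y).
Proof.
move=> w wK; set c := dotp _ w.
have Dt t : 0 <= bregman f x y + t * c.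
  have := bregman_ge0 (x + t *: w) (y + t *: w).
  rewrite /bregman !affine_along_kernel // kernel_grad_const //.
  rewrite (_ : x + t *: w - (y + t *: w) = x - y); last first.
    by rewrite opprD addrACA subrr addr0.
  by rewrite /c dotpBl; lra.
apply/eqP; apply: contraT => c0.
have := Dt (- (bregman f x y + 1) / c); rewrite mulfVK //; lra.
Qed.

Lemma grad_diff_projector (P : 'M[R]_d) x y :
  is_orthogonal_projector P (orthogonal_compl (common_hessian_kernel f)) ->
  (grad f x - grad f y) *m P = grad f x - grad f y.
Proof.
case=> _ PP PR; have := grad_diff_orthogonal x y; rewrite -PR => -[u _ <-].
by rewrite -mulmxA PP.
Qed.

End SmoothConvex.

Lemma smooth_const_ge0 (R : realType) (d : nat) (L : R) (f : 'rV[R]_d -> R) :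
  (0 < d)%N -> smooth L f -> 0 <= L.
Proof.
move=> d0 fs; pose u : 'rV[R]_d := const_mx 1.
have := fs u 0; rewrite subr0 => h.
have u0 : 0 < enorm u.
  rewrite sqrtr_gt0 lt_def dotp_ge0 dotp_eq0 andbT.
  by apply/eqP => /rowP/(_ (Ordinal d0)); rewrite !mxE => /eqP; rewrite oner_eq0.
by rewrite -(pmulr_lge0 _ u0) (le_trans (enorm_ge0 _) h).
Qed.

(** If the gradient [g] at a minimizer were nonzero, a short enough step along
    [- g] would decrease the objective, by its quadratic upper model. *)
Lemma objective_stationary (R : realType) (n m d : nat) (sigma : 'I_n -> R)
  (f : 'I_n -> 'I_m -> 'rV[R]_d -> R) (L : 'I_n -> 'I_m -> R) (x : 'rV[R]_d) :
  (forall i, 0 < sigma i) -> (forall i j y, differentiable (f i j) y) ->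
  (forall i j, 0 <= L i j) -> (forall i j, smooth (L i j) (f i j)) ->
  (forall y, objective sigma f x <= objective sigma f y) ->
  \sum_i (sigma i *: x + \sum_j grad (f i j) x) = 0.
Proof.
move=> s0 fd L0 fs xmin; set g := \sum_i _.
pose C := \sum_i (sigma i / 2 + \sum_j L i j / 2).
have C0 : 0 <= C.
  apply: sumr_ge0 => i _; rewrite addr_ge0 ?divr_ge0 ?(ltW (s0 i)) //.
  by apply: sumr_ge0 => j _; rewrite divr_ge0.
have gg : dotp g g = \sum_i (sigma i * dotp x g + \sum_j dotp (grad (f i j) x) g).
  rewrite {1}/g dotp_suml; apply: eq_bigr => i _.
  by rewrite dotpDl dotpZl dotp_suml.
pose t := (C + 1)^-1; have t0 : 0 < t by rewrite invr_gt0; lra.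
have up : objective sigma f (x - t *: g)
    <= objective sigma f x - t * dotp g g + t ^+ 2 * dotp g g * C.
  rewrite (_ : t * dotp g g = \sum_i t * (sigma i * dotp x g
      + \sum_j dotp (grad (f i j) x) g)); last by rewrite gg mulr_sumr.
  rewrite /C [X in _ <= _ + X]mulr_sumr -sumrB -big_split /=; apply: ler_sum => i _.
  rewrite !enorm_sqr dotpBl !dotpBr !dotpZl !dotpZr (dotpC g x).
  have fj j : f i j (x - t *: g)
      <= f i j x - t * dotp (grad (f i j) x) g + t ^+ 2 * dotp g g * (L i j / 2).
    have := bregman_upper (fd i j) (L0 i j) (fs i j) (x - t *: g) x.
    rewrite /bregman [x - _ - x]addrAC subrr sub0r !(dotpNl, dotpNr, dotpZl, dotpZr).
    lra.
  have := ler_sum _ (fun j (_ : true) => fj j) : _ <= \sum_(j | true) _.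
  rewrite big_split sumrB /= -!mulr_sumr => hj; lra.
have := le_trans (xmin _) up => h.
have h2 : t * dotp g g <= t ^+ 2 * dotp g g * C by lra.
have : dotp g g * (C + 1) <= dotp g g * C.
  rewrite -(ler_pM2l (exprn_gt0 2 t0)) [leRHS]mulrA.
  have -> : t ^+ 2 * (dotp g g * (C + 1)) = t * dotp g g * (t * (C + 1)) by ring.
  by rewrite mulVf ?mulr1 //; lra.
move=> h3; apply/eqP; rewrite -dotp_eq0 eq_le dotp_ge0 andbT; lra.
Qed.

(** * One computation step and the dual bound at one node *)

Section CoordinateStep.
Variables (R : realType) (d : nat) (L : R) (f : 'rV[R]_d -> R).
Hypotheses (f_diff : forall x, differentiable f x) (L_ge0 : 0 <= L)
  (f_smooth : smooth L f) (f_conv : convex_function [set: 'rV[R]_d] f).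

Definition sym_bregman (g : 'rV[R]_d -> R) x y := dotp (grad g x - grad g y) (x - y).

Lemma sym_bregmanE x y : sym_bregman f x y = bregman f x y + bregman f y x.
Proof. by rewrite /sym_bregman /bregman dotpBl -(opprB x y) dotpNr; lra. Qed.

Lemma sym_bregman_ge0 x y : 0 <= sym_bregman f x y.
Proof. by rewrite sym_bregmanE addr_ge0 // bregman_ge0. Qed.

Lemma grad_sqr_le_sym_bregman x y :
  dotp (grad f x - grad f y) (grad f x - grad f y) <= L * sym_bregman f x y.
Proof.
have := cocoercive f_diff L_ge0 f_smooth f_conv x y.
have := cocoercive f_diff L_ge0 f_smooth f_conv y x.
rewrite -(opprB (grad f x)) dotpNl dotpNr opprK sym_bregmanE; lra.
Qed.

(** With [e = z' - z = s (th - z)] and [D] the variation of the gradient, the two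
    sides differ by [(1 / s - 1) <D, e> - |D|^2 / (2 sigma)]. Cocoercivity gives
    [|D|^2 <= L <D, e>], and the step size condition says that [1 / s - 1] is at
    least [L / sigma]. *)
Lemma computation_step_decrease (sigma s : R) (z th z' th' xs : 'rV[R]_d) :
  0 < sigma -> 0 < s -> s * (1 + L / sigma) <= 1 ->
  z' = (1 - s) *: z + s *: th ->
  th' = th - sigma^-1 *: (grad f z' - grad f z) ->
  sym_bregman f z' xs + sigma / 2 * dotp (th' - xs) (th' - xs)
  <= sym_bregman f z xs + sigma / 2 * dotp (th - xs) (th - xs)
     + s * (dotp (grad f z - grad f xs) (th - xs) - sym_bregman f z xs).
Proof.
move=> sg0 s0 sL z'E ->; set D := grad f z' - grad f z.
have z'z : z' - z = s *: (th - z).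
  by rewrite z'E scalerBl scale1r scalerBr addrC addrA [- z + _]addrA addNr add0r addrC.
have co := grad_sqr_le_sym_bregman z' z.
rewrite /sym_bregman -/D z'z dotpZr in co.
have DL : dotp D D <= sigma * (1 - s) * dotp D (th - z).
  apply: le_trans co _.
  have c0 : 0 <= dotp D (th - z).
    by have := sym_bregman_ge0 z' z; rewrite /sym_bregman -/D z'z dotpZr pmulr_rge0.
  rewrite mulrA ler_wpM2r //.
  have : sigma * (s * (1 + L / sigma)) <= sigma * 1 by rewrite ler_pM2l.
  have -> : sigma * (s * (1 + L / sigma)) = sigma * s + L * s.
    by field; rewrite gt_eqF.
  lra.
have gE : grad f z' = grad f z + D by rewrite /D addrC subrK.
have zE : z' = z + s *: (th - z) by rewrite -z'z addrC subrK.
rewrite /sym_bregman gE {1}zE -/D.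
have -> : grad f z + D - grad f xs = (grad f z - grad f xs) + D by rewrite addrAC.
have -> : z + s *: (th - z) - xs = (z - xs) + s *: (th - z) by rewrite addrAC.
have -> : th - sigma^-1 *: D - xs = (th - xs) - sigma^-1 *: D by rewrite addrAC.
have uE : th - z = (th - xs) - (z - xs) by rewrite opprB addrA subrK.
rewrite uE in DL *.
move: (th - xs) (z - xs) (grad f z - grad f xs) DL => u v h DL.
clear -DL sg0; move: D DL => D DL.
rewrite !(dotpDl, dotpDr, dotpNl, dotpNr, dotpZl, dotpZr) in DL *.
rewrite (dotpC u D).
have -> : sigma / 2 * (dotp u u + - (sigma^-1 * dotp D u)
    + (- (sigma^-1 * dotp D u) + - - (sigma^-1 * (sigma^-1 * dotp D D))))
   = sigma / 2 * dotp u u - dotp D u + sigma^-1 * dotp D D / 2.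
  by field; rewrite gt_eqF.
have : sigma^-1 * dotp D D <= (1 - s) * (dotp D u - dotp D v).
  by rewrite mulrC ler_pdivrMr // [_ * sigma]mulrC mulrA.
have : 0 <= sigma^-1 * dotp D D by rewrite mulr_ge0 ?dotp_ge0 // invr_ge0 ltW.
lra.
Qed.

End CoordinateStep.

Section NodeBound.
Variables (R : realType) (d m : nat) (sigma : R) (L : 'I_m -> R) (P : 'I_m -> 'M[R]_d).
Hypotheses (d_gt0 : (0 < d)%N) (sigma_gt0 : 0 < sigma) (L_ge0 : forall j, 0 <= L j)
  (P_sym : forall j, (P j)^T = P j) (P_idem : forall j, P j *m P j = P j).

Let M : 'M[R]_d := \sum_j L j *: P j.

Lemma weighted_projectors_sym : M^T = M.
Proof.
by rewrite /M linear_sum; apply: eq_bigr => j _; rewrite linearZ /= P_sym.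
Qed.

Lemma weighted_projectors_quadratic p (X : 'M[R]_(d, p)) :
  \tr (X^T *m (M *m X)) = \sum_j L j * \tr ((P j *m X)^T *m (P j *m X)).
Proof.
rewrite /M mulmx_suml mulmx_sumr linear_sum; apply: eq_bigr => j _ /=.
by rewrite -scalemxAl -scalemxAr mxtraceZ trmx_mul P_sym -mulmxA [P j *m (_ *m _)]mulmxA P_idem.
Qed.

Lemma weighted_projectors_psd : psd M.
Proof.
move=> p X; rewrite weighted_projectors_quadratic; apply: sumr_ge0 => j _.
by rewrite mulr_ge0 // mxtrace_gram_ge0.
Qed.

Lemma weighted_projectors_upper (v : 'rV[R]_d) :
  \sum_j L j * dotp (v *m P j) (v *m P j) <= lambda_max M * dotp v v.
Proof.
have tr1 (a : 'rV[R]_d) : dotp a a = \tr ((a^T)^T *m a^T).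
  rewrite mxtrace_gram; apply: eq_bigr => k _.
  by rewrite big_ord1 !mxE.
have := rayleigh_le_lambda_max v^T weighted_projectors_sym.
rewrite weighted_projectors_quadratic -tr1; apply: le_trans.
rewrite le_eqVlt; apply/orP; left; apply/eqP; apply: eq_bigr => j _.
by rewrite tr1 !trmx_mul !P_sym.
Qed.

(** Cauchy-Schwarz with one weight per component: testing [y] against each [h j]
    only sees the projection of [y] on the range of [P j], whence the largest
    eigenvalue of the weighted sum of projectors rather than the sum of the
    smoothness constants. *)
Lemma node_dual_bound (u : 'rV[R]_d) (h : 'I_m -> 'rV[R]_d) (q : 'I_m -> R)
    (y := sigma *: u + \sum_j h j) :
  (forall j, h j *m P j = h j) -> (forall j, dotp (h j) (h j) <= L j * q j) ->
  (forall j, 0 <= q j) ->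
  (sigma + lambda_max M)^-1 * dotp y y <= sigma * dotp u u + \sum_j q j.
Proof.
move=> hP hq q0; set D := sigma + lambda_max M.
have D0 : 0 < D.
  rewrite ltr_wpDr // lambda_max_ge0 //; first exact: weighted_projectors_sym.
  exact: weighted_projectors_psd.
have Di0 : 0 < D^-1 by rewrite invr_gt0.
rewrite mulrC ler_pdivrMr //.
have yu : dotp y (sigma *: u) <= (sigma * D^-1 * dotp y y + D * (sigma * dotp u u)) / 2.
  have := dotp_young y (sigma *: u) (mulr_gt0 sigma_gt0 Di0).
  rewrite !dotpZl !dotpZr invfM invrK.
  have -> : sigma^-1 * D * (sigma * (sigma * dotp u u)) = D * (sigma * dotp u u).
    by field; rewrite gt_eqF.
  by [].
have yh j : dotp y (h j) <= (D^-1 * (L j * dotp (y *m P j) (y *m P j)) + D * q j) / 2.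
  rewrite -(hP j) -dotp_mulmx_sym //.
  have [Lj0|Ljn0] := eqVneq (L j) 0.
    have /eqP : dotp (h j) (h j) = 0.
      by apply/eqP; rewrite eq_le dotp_ge0 andbT (le_trans (hq j)) // Lj0 mul0r.
    rewrite dotp_eq0 => /eqP ->; rewrite dotp0 Lj0 mul0r mulr0 add0r.
    by rewrite divr_ge0 // mulr_ge0 // ltW.
  have Lj : 0 < L j by rewrite lt_def Ljn0 L_ge0.
  apply: (le_trans (dotp_young _ _ (mulr_gt0 Di0 Lj))).
  rewrite invfM invrK -mulrA.
  have : D * (L j)^-1 * dotp (h j) (h j) <= D * q j.
    rewrite -mulrA ler_pM2l // mulrC ler_pdivrMr // mulrC; exact: hq.
  lra.
have := ler_sum _ (fun j (_ : true) => yh j) : _ <= \sum_(j | true) _.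
rewrite -dotp_sumr -mulr_suml big_split /= -!mulr_sumr => ysum.
have yy : dotp y y = dotp y (sigma *: u) + dotp y (\sum_j h j) by rewrite -dotpDr.
have := weighted_projectors_upper y => up.
have up2 : D^-1 * (sigma * dotp y y + \sum_j L j * dotp (y *m P j) (y *m P j)) <= dotp y y.
  by rewrite mulrC ler_pdivrMr // /D; lra.
move: ysum up2; rewrite -/y => ysum up2.
have -> : dotp y y = 2 * dotp y y - dotp y y by lra.
rewrite {1}yy; lra.
Qed.

End NodeBound.

(** * The Lyapunov function *)

Lemma big_option (R : realType) (T : finType) (F : option T -> R) :
  \sum_c F c = F None + \sum_x F (Some x).
Proof.
rewrite (bigD1 None) //=; congr (_ + _).
rewrite (reindex_omap Some id) /=; last by case.
by apply: eq_bigl => x; rewrite eqxx.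
Qed.

Section Lyapunov.
Variables (R : realType) (n m d : nat) (sigma : 'I_n -> R)
  (f : 'I_n -> 'I_m -> 'rV[R]_d -> R) (L : 'I_n -> 'I_m -> R) (W : 'M[R]_n)
  (p_comm : R) (p : 'I_n -> 'I_m -> R) (alpha eta : R)
  (xs : 'rV[R]_d) (ws : 'M[R]_(n, d)).

Implicit Types (s : dvr_state R n m d) (w : 'M[R]_(n, d)) (c : dvr_choice n m).

Let k := eta / p_comm.
Let step := dvr_step sigma f W p_comm p alpha eta.

(** The algorithm does not store the dual variable of the communication edges.
    It is [B^T *m w], where [- w] accumulates the scaled parameters over the past
    communication steps; tracking [w] avoids inverting the gossip matrix. *)
Definition dual_step c s w := if c is None then w - k *: dvr_theta s else w.

(** The invariant behind the initialization: both kinds of steps preserve it, and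
    its right-hand side at the optimum is [W *m ws]. *)
Definition dual_consistent s w := forall i,
  row i (W *m w) = sigma i *: row i (dvr_theta s) + \sum_j grad (f i j) (dvr_z s i j).

Definition node_energy s i :=
  \sum_j sym_bregman (f i j) (dvr_z s i j) xs
  + sigma i / 2 * dotp (row i (dvr_theta s) - xs) (row i (dvr_theta s) - xs).

(** The first term is half the squared distance of the edge variables
    [B^T *m w] to their optimum. The second one groups the symmetrized Bregman
    divergences of the components and the primal error; it combines the Bregman
    distance to the dual optimum used by mirror descent with the dual
    suboptimality gap, both with the same weight. *)
Definition lyapunov s w :=
  \tr ((w - ws)^T *m (W *m (w - ws))) / 2 + alpha^-1 * \sum_i node_energy s i.

Hypotheses (sigma_gt0 : forall i, 0 < sigma i).

Lemma row_comm_step (th : 'M[R]_(n, d)) i :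
  row i (th - k *: (diag_mx (\row_(i < n) (sigma i)^-1) *m W *m th))
  = row i th - (k * (sigma i)^-1) *: row i (W *m th).
Proof.
apply/rowP => b; rewrite -mulmxA 4!mxE mul_diag_mx !mxE; congr (_ - _); ring.
Qed.

Lemma dual_consistent_step c s w :
  dual_consistent s w -> dual_consistent (step c s) (dual_step c s w).
Proof.
rewrite /step; case: s => z th; case: c => [J|] /= inv i; have /= {inv} := inv i.
  move=> ->; rewrite rowK scalerBr scalerA.
  have si0 : sigma i != 0 by rewrite gt_eqF.
  rewrite (mulfV si0) scale1r.
  rewrite (bigD1 (J i)) //= [in RHS](bigD1 (J i)) //= eqxx.
  set a := grad (f i (J i)) (z i (J i)); set b := grad _ (_ + _).
  have -> : \sum_(j | j != J i) grad (f i j)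
      (if j == J i then (1 - alpha * eta / p i j) *: z i j
                        + (alpha * eta / p i j) *: row i th else z i j)
    = \sum_(j | j != J i) grad (f i j) (z i j).
    by apply: eq_bigr => j /negbTE ->.
  by rewrite -addrA; congr (_ + _); rewrite addrA opprB subrK.
move=> wE; rewrite row_comm_step scalerBr mulmxBr linearB /= wE -scalemxAr linearZ /=.
by rewrite scalerA mulrCA mulfV ?gt_eqF // mulr1 addrAC.
Qed.

Hypotheses (W_sym : W^T = W)
  (W_const : forall x : 'rV[R]_d, W *m (\matrix_(i < n) x) = 0)
  (ws_opt : forall i, row i (W *m ws) = sigma i *: xs + \sum_j grad (f i j) xs).

Lemma mxtrace_sym_form (X Y : 'M[R]_(n, d)) :
  \tr (X^T *m (W *m Y)) = \tr (Y^T *m (W *m X)).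
Proof. by rewrite -mxtrace_tr !trmx_mul trmxK W_sym mulmxA. Qed.

Definition error_mx s : 'M[R]_(n, d) := dvr_theta s - \matrix_(i < n) xs.

Lemma row_error_mx s i : row i (error_mx s) = row i (dvr_theta s) - xs.
Proof. by rewrite /error_mx linearB /= rowK. Qed.

Lemma gossip_error_mx s : W *m error_mx s = W *m dvr_theta s.
Proof. by rewrite /error_mx mulmxBr W_const subr0. Qed.

Lemma node_energy_sum s : \sum_i node_energy s i =
  \sum_i \sum_j sym_bregman (f i j) (dvr_z s i j) xs
  + (\sum_i sigma i * dotp (row i (error_mx s)) (row i (error_mx s))) / 2.
Proof.
rewrite mulr_suml -big_split; apply: eq_bigr => i _; rewrite /node_energy row_error_mx.
by rewrite /= mulrAC.
Qed.

Lemma lyapunov_comm_step s w :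
  let T := \tr ((error_mx s)^T *m (W *m error_mx s)) in
  lyapunov (step None s) (dual_step None s w) =
  lyapunov s w - k * \tr ((error_mx s)^T *m (W *m (w - ws))) + k ^+ 2 / 2 * T
  + alpha^-1 * (- (k * T) + k ^+ 2 / 2 *
     \sum_i (sigma i)^-1 * dotp (row i (W *m error_mx s)) (row i (W *m error_mx s))).
Proof.
move=> T; rewrite /lyapunov !node_energy_sum.
have zE : dvr_z (step None s) = dvr_z s by case: (s).
have eE i : row i (error_mx (step None s))
    = row i (error_mx s) - (k * (sigma i)^-1) *: row i (W *m error_mx s).
  rewrite gossip_error_mx !row_error_mx /step; case: (s) => z th /=.
  by rewrite row_comm_step addrAC.
rewrite zE /=.
have -> : w - k *: dvr_theta s - ws = (w - ws) - k *: dvr_theta s by rewrite addrAC.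
have -> : \tr ((w - ws - k *: dvr_theta s)^T *m (W *m (w - ws - k *: dvr_theta s)))
   = \tr ((w - ws)^T *m (W *m (w - ws))) - 2 * k * \tr ((error_mx s)^T *m (W *m (w - ws)))
     + k ^+ 2 * T.
  have trD (X : 'M[R]_(n, d)) :
      \tr ((dvr_theta s)^T *m (W *m X)) = \tr ((error_mx s)^T *m (W *m X)).
    by rewrite mxtrace_sym_form -gossip_error_mx mxtrace_sym_form.
  rewrite /T -!trD (mxtrace_sym_form _ (error_mx s)) -trD.
  move: (w - ws) => de; rewrite [(de - _)^T]linearB /= [(k *: _)^T]linearZ /=.
  rewrite (mulmxBr W) mulmxBl !mulmxBr -!scalemxAr -!scalemxAl.
  rewrite !linearB /= !linearZ /= (mxtrace_sym_form de (dvr_theta s)) /GRing.scale /=; ring.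
have -> : \sum_i sigma i * dotp (row i (error_mx (step None s))) (row i (error_mx (step None s)))
  = \sum_i sigma i * dotp (row i (error_mx s)) (row i (error_mx s)) - 2 * k * T
   + k ^+ 2 * \sum_i (sigma i)^-1 * dotp (row i (W *m error_mx s)) (row i (W *m error_mx s)).
  rewrite /T mxtrace_gram_rows !mulr_sumr -sumrB -big_split; apply: eq_bigr => i _ /=.
  rewrite eE dotpBl !dotpBr !dotpZl !dotpZr (dotpC (row i (W *m _)) (row i (error_mx s))).
  by field; rewrite gt_eqF.
by move: alpha^-1 => a; field.
Qed.

Hypotheses (f_diff : forall i j x, differentiable (f i j) x)
  (L_ge0 : forall i j, 0 <= L i j) (f_smooth : forall i j, smooth (L i j) (f i j))
  (f_conv : forall i j, convex_function [set: 'rV[R]_d] (f i j))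
  (alpha_gt0 : 0 < alpha) (eta_gt0 : 0 < eta)
  (eta_comp : forall i j, alpha * eta * (1 + L i j / sigma i) <= p i j).

Lemma node_energy_comp_step (J : {ffun 'I_n -> 'I_m}) s i :
  node_energy (step (Some J) s) i <= node_energy s i
  + alpha * eta / p i (J i) *
     (dotp (grad (f i (J i)) (dvr_z s i (J i)) - grad (f i (J i)) xs)
           (row i (error_mx s)) - sym_bregman (f i (J i)) (dvr_z s i (J i)) xs).
Proof.
have ae0 : 0 < alpha * eta by rewrite mulr_gt0.
have Ls0 j : 0 <= L i j / sigma i by rewrite divr_ge0 // ltW.
have p0 j : 0 < p i j.
  by apply: lt_le_trans (eta_comp i j); rewrite mulr_gt0 // ltr_wpDr.
rewrite row_error_mx /step /node_energy; case: s => z th /=.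
set s := alpha * eta / p i (J i).
have s0 : 0 < s by rewrite divr_gt0.
have sL : s * (1 + L i (J i) / sigma i) <= 1.
  by rewrite /s mulrAC ler_pdivrMr // mul1r.
have := computation_step_decrease (f_diff i (J i)) (L_ge0 i (J i)) (f_smooth i (J i))
  (f_conv i (J i)) xs (sigma_gt0 i) s0 sL
  (erefl ((1 - s) *: z i (J i) + s *: row i th)) erefl => descent.
rewrite rowK (bigD1 (J i)) //= [in leRHS](bigD1 (J i)) //= eqxx -/s.
have -> : \sum_(j | j != J i) sym_bregman (f i j)
      (if j == J i then (1 - alpha * eta / p i j) *: z i j
                        + (alpha * eta / p i j) *: row i th else z i j) xs
    = \sum_(j | j != J i) sym_bregman (f i j) (z i j) xs.
  by apply: eq_bigr => j /negbTE ->.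
by move: descent; set A := \sum_(j | _) _; lra.
Qed.

Variables (Lam mu0 : R) (dinv : 'I_n -> R) (q : dvr_choice n m -> R).
Hypotheses (alphaE : alpha = 2 * mu0) (p_comm_gt0 : 0 < p_comm)
  (Lam_gt0 : 0 < Lam) (mu0_le : mu0 <= Lam) (eta_comm : eta * Lam <= p_comm)
  (W_psd : forall X : 'M[R]_(n, d), 0 <= \tr (X^T *m (W *m X)))
  (W_upper : forall X : 'M[R]_(n, d), \tr (X^T *m (W *m X))
     <= Lam * \sum_i sigma i * dotp (row i X) (row i X))
  (W_upper2 : forall X : 'M[R]_(n, d),
     \sum_i (sigma i)^-1 * dotp (row i (W *m X)) (row i (W *m X))
     <= Lam * \tr (X^T *m (W *m X)))
  (W_lower : forall X : 'M[R]_(n, d), mu0 * \tr (X^T *m (W *m X))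
     <= \sum_i dinv i * dotp (row i (W *m X)) (row i (W *m X)))
  (node_bound : forall i (u : 'rV[R]_d) (z : 'I_m -> 'rV[R]_d)
     (y := sigma i *: u + \sum_j (grad (f i j) (z j) - grad (f i j) xs)),
     dinv i * dotp y y <= sigma i * dotp u u + \sum_j sym_bregman (f i j) (z j) xs)
  (q_ge0 : forall c, 0 <= q c) (q_sum : \sum_c q c = 1) (q_comm : q None = p_comm)
  (q_comp : forall i j, \sum_(J : {ffun 'I_n -> 'I_m} | J i == j) q (Some J) = p i j).

Lemma gossip_error_gap s w i : dual_consistent s w ->
  row i (W *m (w - ws)) = sigma i *: row i (error_mx s)
    + \sum_j (grad (f i j) (dvr_z s i j) - grad (f i j) xs).
Proof.
move=> inv; rewrite mulmxBr linearB /= inv ws_opt row_error_mx scalerBr sumrB.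
by rewrite opprD addrACA.
Qed.

(** Writing [S] for the weighted primal error, [Q] for the sum of the divergences,
    [N] for the squared distance of the edge variables and [C] for the cross term
    between gradient variations and primal errors, a communication step
    contributes at most [- eta (S + C) + eta S / 4] in expectation and a
    computation step at most [eta (C - Q)]. The cross terms cancel, and [mu0 N <= S + Q] turns the
    remaining decrease into a fraction [alpha eta / 2] of the Lyapunov
    function; the constants leave no slack. *)
Lemma lyapunov_drift s w : dual_consistent s w ->
  \sum_c q c * lyapunov (step c s) (dual_step c s w)
  <= (1 - alpha * eta / 2) * lyapunov s w.
Proof.
move=> inv; rewrite big_option q_comm.
pose N := \tr ((w - ws)^T *m (W *m (w - ws))).
pose T := \tr ((error_mx s)^T *m (W *m error_mx s)).
pose S := \sum_i sigma i * dotp (row i (error_mx s)) (row i (error_mx s)).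
pose Q := \sum_i \sum_j sym_bregman (f i j) (dvr_z s i j) xs.
pose h i j := grad (f i j) (dvr_z s i j) - grad (f i j) xs.
pose C := \sum_i \sum_j dotp (h i j) (row i (error_mx s)).
have ae0 : 0 < alpha * eta by rewrite mulr_gt0.
have p0 i j : 0 < p i j.
  apply: lt_le_trans (eta_comp i j); rewrite mulr_gt0 // ltr_wpDr //.
  by rewrite divr_ge0 // ltW.
have cross : \tr ((error_mx s)^T *m (W *m (w - ws))) = S + C.
  rewrite mxtrace_gram_rows /S /C -big_split; apply: eq_bigr => i _ /=.
  rewrite (gossip_error_gap _ inv) dotpDr dotpZr dotp_sumr; congr (_ + _).
  by apply: eq_bigr => j _; rewrite dotpC.
have NSQ : mu0 * N <= S + Q.
  apply: (le_trans (W_lower _)); rewrite /S /Q -big_split /=; apply: ler_sum => i _.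
  by rewrite (gossip_error_gap _ inv).
(* The energies of the nodes add up, so the expectation over J reduces to the
   marginals p i j. *)
have comp : \sum_J q (Some J) * lyapunov (step (Some J) s) (dual_step (Some J) s w)
    <= (1 - p_comm) * lyapunov s w + eta * (C - Q).
  pose dl i j := alpha * eta / p i j * (dotp (h i j) (row i (error_mx s))
                    - sym_bregman (f i j) (dvr_z s i j) xs).
  have lyJ J : lyapunov (step (Some J) s) (dual_step (Some J) s w)
      <= lyapunov s w + alpha^-1 * \sum_i dl i (J i).
    rewrite /lyapunov -addrA lerD2l -mulrDr ler_pM2l ?invr_gt0 // -big_split.
    by apply: ler_sum => i _; apply: node_energy_comp_step.
  apply: (@le_trans _ _ (\sum_J q (Some J) * (lyapunov s w + alpha^-1 * \sum_i dl i (J i)))).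
    by apply: ler_sum => J _; apply: ler_wpM2l.
  have qS : \sum_J q (Some J) = 1 - p_comm.
    by rewrite -q_sum big_option q_comm addrC addKr.
  under eq_bigr do rewrite mulrDr.
  rewrite big_split /= -mulr_suml qS lerD2l.
  have -> : \sum_J q (Some J) * (alpha^-1 * \sum_i dl i (J i))
      = alpha^-1 * \sum_i \sum_j p i j * dl i j.
    under eq_bigr do rewrite mulrCA mulr_sumr.
    rewrite -mulr_sumr exchange_big; congr (_ * _); apply: eq_bigr => i _.
    rewrite (partition_big (fun J : {ffun 'I_n -> 'I_m} => J i) predT) //=.
    apply: eq_bigr => j _; rewrite -q_comp mulr_suml.
    by apply: eq_bigr => J /eqP ->.
  rewrite le_eqVlt; apply/orP; left; apply/eqP.
  rewrite /C /Q -sumrB !mulr_sumr; apply: eq_bigr => i _.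
  rewrite -sumrB !mulr_sumr; apply: eq_bigr => j _; rewrite /dl.
  by field; rewrite !gt_eqF.
rewrite lyapunov_comm_step cross -/T.
set Q2 := \sum_i (sigma i)^-1 * _.
have Q2T : Q2 <= Lam * T := W_upper2 _.
have TS : T <= Lam * S := W_upper _.
have T0 : 0 <= T := W_psd _.
have k0 : 0 < k by rewrite divr_gt0.
have pk : p_comm * k = eta by rewrite /k mulrC divfK // gt_eqF.
have kLam : k * Lam <= 1 by rewrite /k mulrAC ler_pdivrMr // mul1r.
have ai0 : 0 < alpha^-1 by rewrite invr_gt0.
have lyE : lyapunov s w = N / 2 + alpha^-1 * (Q + S / 2) by rewrite /lyapunov node_energy_sum.
(* This is where mu0 <= Lam is needed: alpha * eta is at most 2 * p_comm. *)
have akle : k <= 2 * alpha^-1.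
  rewrite -ler_pdivrMr // invrK (le_trans _ (_ : 2 * (k * Lam) <= 2)) //; last by lra.
  by rewrite alphaE mulrCA ler_pM2l // ler_pM2l.
have e1 : alpha^-1 * (- (k * T) + k ^+ 2 / 2 * Q2) <= - (alpha^-1 * k * T / 2).
  have -> : - (alpha^-1 * k * T / 2) = alpha^-1 * - (k * T / 2) by ring.
  rewrite ler_pM2l //.
  have : k * (k * Q2) <= k * T.
    rewrite ler_pM2l // (le_trans (_ : _ <= k * (Lam * T))) ?ler_pM2l //.
    by rewrite mulrA -[leRHS]mul1r ler_wpM2r.
  rewrite expr2; lra.
have e2 : k ^+ 2 / 2 * T - alpha^-1 * k * T / 2 <= k * S / 4.
  have h1 : k * (k * T) <= 2 * alpha^-1 * (k * T) by rewrite ler_wpM2r // mulr_ge0 // ltW.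
  have h2 : k * (k * T) <= k * S.
    rewrite ler_pM2l // (le_trans (_ : _ <= k * (Lam * S))) ?ler_pM2l //.
    rewrite mulrA -[leRHS]mul1r ler_wpM2r //.
    by apply: sumr_ge0 => i _; rewrite mulr_ge0 ?dotp_ge0 // ltW.
  rewrite expr2; lra.
have comm : p_comm * (lyapunov s w - k * (S + C) + k ^+ 2 / 2 * T
      + alpha^-1 * (- (k * T) + k ^+ 2 / 2 * Q2))
    <= p_comm * lyapunov s w - eta * (S + C) + eta * S / 4.
  rewrite -pk; have := ler_wpM2l (ltW p_comm_gt0) (lerD e1 e2); lra.
apply: (le_trans (lerD comm comp)).
have key : alpha * eta / 2 * lyapunov s w <= 3 / 4 * (eta * S) + eta * Q.
  rewrite lyE.
  have -> : alpha * eta / 2 * (N / 2 + alpha^-1 * (Q + S / 2))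
      = eta * (mu0 * N) / 2 + eta * (Q + S / 2) / 2.
    rewrite {1}alphaE; have an0 : alpha != 0 by rewrite gt_eqF.
    have m0 : mu0 != 0 by move: an0; rewrite alphaE mulf_eq0 negb_or => /andP[].
    by rewrite alphaE; field.
  have := ler_wpM2l (ltW eta_gt0) NSQ; lra.
lra.
Qed.

Lemma node_energy_ge0 s i : 0 <= node_energy s i.
Proof.
rewrite addr_ge0 //; last first.
  by rewrite mulr_ge0 ?dotp_ge0 // divr_ge0 // ltW.
by apply: sumr_ge0 => j _; apply: sym_bregman_ge0.
Qed.

Lemma sq_error_le_lyapunov s w :
  sq_error xs s <= alpha * (\sum_i (sigma i)^-1) * lyapunov s w.
Proof.
rewrite mulrAC mulr_sumr /sq_error; apply: ler_sum => i _.
have le_node : node_energy s i <= alpha * lyapunov s w.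
  rewrite /lyapunov mulrDr [X in _ <= _ + X]mulVKf ?gt_eqF // ler_wpDl //.
    by rewrite mulr_ge0 ?divr_ge0 // ltW.
  by rewrite (bigD1 i) //= lerDl; apply: sumr_ge0 => j _; apply: node_energy_ge0.
rewrite enorm_sqr ler_pdivlMr // (le_trans _ le_node) // /node_energy.
set e := dotp _ _; have : 0 <= \sum_j sym_bregman (f i j) (dvr_z s i j) xs.
  by apply: sumr_ge0 => j _; apply: sym_bregman_ge0.
lra.
Qed.

End Lyapunov.

(** * Expectations along a finite-choice process *)

Section FiniteRandomVariable.
Variables (R : realType) (dsp : measure_display) (T : measurableType dsp)
  (Pr : probability T R) (K : finType) (Y : T -> K).
Hypothesis (Y_meas : forall k, measurable (Y @^-1` [set k])).

Definition pmass k : R := fine (Pr (Y @^-1` [set k])).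

Lemma pmassE k : Pr (Y @^-1` [set k]) = (pmass k)%:E.
Proof. by rewrite /pmass fineK // fin_num_measure. Qed.

Lemma pmass_ge0 k : 0 <= pmass k.
Proof. by rewrite fine_ge0. Qed.

Lemma expectation_finite (g : K -> R) : (forall k, 0 <= g k) ->
  'E_Pr[fun w => g (Y w)]%E = (\sum_k g k * pmass k)%:E.
Proof.
move=> g0; rewrite unlock.
under eq_integral => w _.
  rewrite (_ : g (Y w) = \sum_k g k * \1_(Y @^-1` [set k]) w); last first.
    rewrite (bigD1 (Y w)) //= indicE mem_set // mulr1 big1 ?addr0 // => k kY.
    by rewrite indicE memNset ?mulr0 // => /= /esym/eqP; apply/negP.
  rewrite -sumEFin.
  over.
rewrite ge0_integral_sum //; first last.
- by move=> k w _; rewrite lee_fin mulr_ge0.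
- move=> k; apply/measurable_EFinP; apply: measurable_funM; first exact: measurable_cst.
  exact: measurable_indic.
rewrite -sumEFin; apply: eq_bigr => k _.
rewrite (@integralZl_indic _ _ _ Pr setT measurableT (fun=> Y @^-1` [set k])) //.
  by rewrite integral_indic // setIT EFinM -pmassE.
by move=> gk; move: (g0 k); rewrite leNgt gk.
Qed.

Lemma probability_pmass (A : pred K) :
  Pr [set w | A (Y w)] = (\sum_(k | A k) pmass k)%:E.
Proof.
have mA : measurable [set w | A (Y w)].
  rewrite (_ : [set w | A (Y w)] = \bigcup_(k in [set k | A k]) (Y @^-1` [set k])).
    by apply: fin_bigcup_measurable => //; exact: finite_finset.
  by apply/seteqP; split => [w Aw|w [k Ak YwE]] /=; [exists (Y w) | rewrite YwE].
transitivity ('E_Pr[fun w => (A (Y w))%:R])%E.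
  rewrite unlock -(setIT [set w | _]) -integral_indic //.
  apply: eq_integral => w _; rewrite indicE.
  by case AY: (A (Y w)); [rewrite mem_set | rewrite memNset //= AY].
rewrite (expectation_finite (g := fun k => (A k)%:R)) // [in RHS]big_mkcond /=.
by congr EFin; apply: eq_bigr => k _; case: (A k); rewrite ?mul1r ?mul0r.
Qed.

Lemma measurable_finite (g : K -> R) : measurable_fun setT (fun w => g (Y w)).
Proof.
move=> _ B mB; rewrite setTI.
rewrite (_ : _ @^-1` B = \bigcup_(k in [set k | B (g k)]) (Y @^-1` [set k])).
  by apply: fin_bigcup_measurable => //; exact: finite_finset.
by apply/seteqP; split => [w Bw|w [k Bk YwE]] /=; [exists (Y w) | rewrite YwE].
Qed.

Lemma sum_pmass : \sum_k pmass k = 1.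
Proof.
have := probability_pmass predT; rewrite (_ : [set w | _] = setT).
  by rewrite probability_setT => -[<-].
exact/seteqP.
Qed.

End FiniteRandomVariable.

Section MarkovChain.
Variables (R : realType) (dsp : measure_display) (T : measurableType dsp)
  (Pr : probability T R) (C : finType) (c0 : C) (xi : nat -> T -> C).
Hypotheses (xi_meas : forall t c, measurable (xi t @^-1` [set c]))
  (xi_indep : forall t (h : nat -> C),
        Pr [set w | forall u, (u <= t)%N -> xi u w = h u] =
        (Pr [set w | forall u, (u < t)%N -> xi u w = h u] *
         Pr [set w | xi t w = h t])%E).

(** Most recent choice first, so that the state is a right fold of the steps over
    this sequence. *)
Fixpoint past t w : t.-tuple C :=
  if t is t'.+1 then cons_tuple (xi t' w) (past t' w) else nil_tuple C.

(** The same choices in chronological order, as a function of time; [c0] is the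
    default beyond the length of the sequence. *)
Definition past_fun (h : seq C) u := nth c0 (rev h) u.

Lemma past_fun_last t c (h : t.-tuple C) : past_fun (c :: h) t = c.
Proof. by rewrite /past_fun rev_cons nth_rcons size_rev size_tuple ltnn eqxx. Qed.

Lemma past_fun_init t c (h : t.-tuple C) u : (u < t)%N ->
  past_fun (c :: h) u = past_fun h u.
Proof. by move=> ut; rewrite /past_fun rev_cons nth_rcons size_rev size_tuple ut. Qed.

Lemma past_funE t w (h : t.-tuple C) :
  past t w = h <-> (forall u, (u < t)%N -> xi u w = past_fun h u).
Proof.
elim: t h => [h|t IH h]; first by rewrite tuple0 [h]tuple0.
case: (tupleP h) => c h' /=.
have last_c := past_fun_last c h'.
have init u (ut : (u < t)%N) := past_fun_init c h' ut.
split.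
  move=> /(congr1 val) /= [ce e] u; rewrite ltnS leq_eqVlt => /orP[/eqP ->|ut].
    by rewrite last_c.
  by rewrite init //; apply: (IH h').1 ut; apply: val_inj.
move=> hx; apply: val_inj => /=; congr (_ :: _).
  by rewrite hx // last_c.
by congr val; apply/IH => u ut; rewrite hx ?init // ltnS ltnW.
Qed.

Lemma past_meas t (h : t.-tuple C) : measurable (past t @^-1` [set h]).
Proof.
elim: t h => [h|t IH h].
  by rewrite (_ : _ @^-1` _ = setT) //; apply/seteqP; split => // w _ /=; rewrite tuple0 [h]tuple0.
case: (tupleP h) => c h'.
rewrite (_ : _ @^-1` _ = (xi t @^-1` [set c]) `&` (past t @^-1` [set h'])).
  exact: measurableI.
apply/seteqP; split => w /=; first by move=> /(congr1 val) /= [-> /val_inj ->].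
by move=> [-> ->].
Qed.

Lemma pmass_past t c (h : t.-tuple C) :
  pmass Pr (past t.+1) (cons_tuple c h) = pmass Pr (past t) h * pmass Pr (xi t) c.
Proof.
have last_c := past_fun_last c h.
have init u (ut : (u < t)%N) := past_fun_init c h ut.
apply: EFin_inj; rewrite EFinM -!pmassE //; try exact: past_meas.
have := xi_indep t (past_fun (c :: h)); rewrite last_c.
rewrite (_ : [set w | forall u, (u <= t)%N -> _] = past t.+1 @^-1` [set (cons_tuple c h)]).
  rewrite (_ : [set w | forall u, (u < t)%N -> _] = past t @^-1` [set h]) //.
  apply/seteqP; split => w /= hw.
    by apply/past_funE => u ut; rewrite hw // init.
  by move=> u ut; rewrite init //; apply: (past_funE w h).1 ut.
by apply/seteqP; split => w /= hw; [exact: (past_funE w (cons_tuple c h)).2 hw |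
  exact: (past_funE w (cons_tuple c h)).1 hw].
Qed.

Variables (X : Type) (step : C -> X -> X) (x0 : X).

Fixpoint chain (c : nat -> C) t : X :=
  if t is t'.+1 then step (c t') (chain c t') else x0.

Lemma chain_past t w : chain (xi ^~ w) t = foldr step x0 (past t w).
Proof. by elim: t => //= t ->. Qed.

(** A supermartingale argument in finite form: at each time the state takes
    finitely many values, and independence factors the mass of a path into that
    of its past and that of the last choice. The law of the choice may change
    with time. *)
Lemma expectation_chain_le (G V : X -> R) (inv : X -> Prop) (r : R) :
  (forall x, 0 <= G x) -> (forall x, inv x -> G x <= V x) ->
  inv x0 -> (forall c x, inv x -> inv (step c x)) -> 0 <= r ->
  (forall t x, inv x -> \sum_c pmass Pr (xi t) c * V (step c x) <= r * V x) ->
  forall t, ('E_Pr[fun w => G (chain (xi ^~ w) t)] <= (V x0 * r ^+ t)%:E)%E.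
Proof.
move=> G0 GV inv0 invS r0 drift t.
have invF (h : seq C) : inv (foldr step x0 h) by elim: h => //= c h; apply: invS.
have -> : (fun w => G (chain (xi ^~ w) t)) = (fun w => G (foldr step x0 (past t w))).
  by apply/funext => w; rewrite chain_past.
rewrite (expectation_finite Pr (past_meas (t := t)) (g := fun h => G (foldr step x0 h))) //.
rewrite lee_fin.
apply: (@le_trans _ _ (\sum_(h : t.-tuple C) V (foldr step x0 h) * pmass Pr (past t) h)).
  by apply: ler_sum => h _; apply: ler_wpM2r; [exact: pmass_ge0 | exact: GV].
elim: t => [|t IH].
  rewrite (big_pred1 [tuple]) => [|h]; last first.
    by apply/esym/eqP; rewrite [h]tuple0; apply: val_inj.
  rewrite /= expr0 mulr1 ler_piMr //; first by apply: le_trans (G0 _) (GV _ inv0).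
  by rewrite -lee_fin -pmassE ?probability_le1 //; exact: past_meas.
rewrite exprS mulrCA.
apply: le_trans (ler_wpM2l r0 IH); rewrite mulr_sumr.
rewrite (reindex (fun hc : t.-tuple C * C => cons_tuple hc.2 hc.1)) /=; last first.
  exists (fun h : t.+1.-tuple C => (behead_tuple h, thead h)) => [[h c] _|h _] /=.
    by congr (_, _); apply: val_inj.
  by rewrite [RHS]tuple_eta.
rewrite -(pair_bigA _ (fun (h : t.-tuple C) (c : C) =>
  V (step c (foldr step x0 h)) * pmass Pr (past t.+1) (cons_tuple c h))) /=.
apply: ler_sum => h _.
under eq_bigr do rewrite pmass_past mulrCA [V _ * _]mulrC.
rewrite -mulr_sumr mulrA [leRHS]mulrC; apply: ler_wpM2l; first exact: pmass_ge0.
exact: drift.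
Qed.

End MarkovChain.

(** * Removing the Kronecker factor *)

Section Tensor.
Variables (R : realType) (n E d : nat) (src dst : 'I_E -> 'I_n) (mu : 'I_E -> R).

Local Notation I := (1%:M : 'M[R]_d).

Lemma tens1_inj p q (M N : 'M[R]_(p, q)) : (0 < d)%N -> M *t I = N *t I -> M = N.
Proof.
move=> d0 MN; pose o := Ordinal d0; apply/matrixP => i j.
have /matrixP/(_ (mxtens_index (i, o)) (mxtens_index (j, o))) := MN.
by rewrite !tensmxE !mxE eqxx !mulr1.
Qed.

Lemma tens1_id p : (1%:M : 'M[R]_p) *t I = 1%:M.
Proof.
apply/matrixP => a b; case: (mxtens_indexP a) => i k; case: (mxtens_indexP b) => j l.
rewrite tensmxE !mxE (can_eq (@mxtens_indexK p d)) xpair_eqE.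
by case: (i == j); case: (k == l); rewrite /= ?mulr1 ?mulr0.
Qed.

Lemma invmx_diag_tens1 (s : 'I_n -> R) : (forall i, 0 < s i) ->
  invmx (diag_mx (\row_i s i) *t I) = diag_mx (\row_i (s i)^-1) *t I.
Proof.
move=> s0; set D := (X in invmx X); set D' := RHS.
have DD : D *m D' = 1%:M.
  rewrite /D /D' tensmx_mul mulmx1 (_ : _ *m _ = 1%:M) ?tens1_id //.
  apply/matrixP => i j; rewrite mul_diag_mx !mxE.
  by case: eqVneq => [->|_]; rewrite ?mulr0 // mulr1n mulfV // gt_eqF.
have [Du _] := mulmx1_unit DD.
by rewrite -[RHS](mulKmx Du) DD mulmx1.
Qed.

Lemma A_comm_gram (s : 'I_n -> R) :
  (A_comm d src dst mu)^T *m (diag_mx (\row_i s i) *t I) *m A_comm d src dst mu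
  = edge_gram src dst mu s *t I.
Proof. by rewrite /A_comm trmx_tens trmx1 !tensmx_mul !mulmx1. Qed.

Lemma gossip_matrixE (W : 'M[R]_n) : (0 < d)%N ->
  W *t I = A_comm d src dst mu *m (A_comm d src dst mu)^T ->
  W = incidence src dst mu *m (incidence src dst mu)^T.
Proof.
by move=> d0; rewrite /A_comm trmx_tens trmx1 tensmx_mul mulmx1 => /(tens1_inj d0).
Qed.

End Tensor.

(** * Number of iterations and expected time *)

Section IterationCount.
Variable R : realType.

(** The bounds on [eps] make [ln eps^-1] at least 1 and at least [ln C0]. After
    [4 ln eps^-1 / a] iterations the power of the rate is below
    [eps ^+ 2 <= eps / C0]; the constant 5 absorbs the rounding up. *)
Lemma iteration_count_bound (C0 a eps : R) :
  0 < C0 -> 0 < a -> a <= 1 -> 0 < eps -> eps <= C0^-1 -> eps <= expR (-1) ->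
  exists2 K, is_iteration_count C0 (1 - a / 2) eps K & a * K%:R <= 5 * ln eps^-1.
Proof.
move=> C00 a0 a1 e0 eC e1; set l := ln eps^-1.
have lE : expR (- l) = eps by rewrite /l lnV ?posrE // opprK lnK ?posrE.
have l1 : 1 <= l.
  by rewrite -(lerN2) -ler_expR lE.
pose N := (Num.truncn (4 * l / a)).+1.
have Nlt : 4 * l / a < N%:R.
  by apply: truncnS_gt.
have Nle : N%:R <= 4 * l / a + 1.
  rewrite /N -natr1 lerD2r truncn_le divr_ge0 //; [lra | exact: ltW].
have r0 : 0 <= 1 - a / 2 by lra.
have PN : C0 * (1 - a / 2) ^+ N <= eps.
  have rN : (1 - a / 2) ^+ N <= eps * eps.
    have re : 1 - a / 2 <= expR (- (a / 2)) by have := expR_ge1Dx (- (a / 2)); lra.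
    apply: (@le_trans _ _ (expR (- (a / 2)) ^+ N)).
      by apply: lerXn2r => //; rewrite nnegrE ?expR_ge0.
    rewrite -expRM_natr -[in leRHS]lE -expRD ler_expR.
    move: Nlt; rewrite ltr_pdivrMr // => Nlt; lra.
  apply: (le_trans (ler_wpM2l (ltW C00) rN)); rewrite mulrA -[leRHS]mul1r ler_pM2r //.
  by rewrite mulrC -ler_pdivlMr // mul1r.
have exP : exists k, C0 * (1 - a / 2) ^+ k <= eps by exists N.
case: (ex_minnP exP) => K PK Kmin; exists K; first by split.
apply: (@le_trans _ _ (a * N%:R)); first by rewrite ler_pM2l // ler_nat Kmin.
apply: (le_trans (ler_wpM2l (ltW a0) Nle)).
rewrite mulrDr mulr1 mulrCA mulfV ?gt_eqF // mulr1; lra.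
Qed.

End IterationCount.

Section Sampling.
Variables (R : realType) (n m : nat) (p_comm : R) (p : 'I_n -> 'I_m -> R)
  (dsp : measure_display) (T : measurableType dsp)
  (Pr : probability T R) (xi : nat -> T -> dvr_choice n m).
Hypothesis sampling : dvr_sampling p_comm p Pr xi.

Lemma sampling_meas t c : measurable (xi t @^-1` [set c]).
Proof. by have [] := sampling. Qed.

Lemma pmass_comm t : pmass Pr (xi t) None = p_comm.
Proof.
have [meas _ comm _] := sampling; apply: EFin_inj; rewrite -pmassE //; exact: comm.
Qed.

Lemma pmass_comp t i j :
  \sum_(J : {ffun 'I_n -> 'I_m} | J i == j) pmass Pr (xi t) (Some J) = p i j.
Proof.
have [meas _ _ comp] := sampling; apply: EFin_inj; rewrite -(comp t).
pose A (c : dvr_choice n m) := if c is Some J then J i == j else false.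
rewrite (_ : [set w | _] = [set w | A (xi t w)]).
  rewrite probability_pmass //; congr EFin.
  by rewrite [RHS]big_mkcond big_option /= add0r -big_mkcond.
apply/seteqP; split => w /=; first by move=> [J -> /= ->]; rewrite eqxx.
by case: (xi t w) => //= J /eqP Jij; exists J.
Qed.

Lemma expectation_run_time tau K : 0 <= tau ->
  'E_Pr[fun w => run_time tau (xi ^~ w) K]%E
    = (K%:R * (p_comm * tau + (1 - p_comm)))%:E.
Proof.
move=> tau0; have st0 c : 0 <= @step_time R n m tau c by rewrite /step_time; case: c.
have one t : 'E_Pr[fun w => step_time tau (xi t w)]%E = (p_comm * tau + (1 - p_comm))%:E.
  rewrite (expectation_finite Pr (sampling_meas t)) //; congr EFin.
  rewrite big_option /= pmass_comm mulrC; congr (_ + _).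
  have := sum_pmass Pr (sampling_meas t); rewrite big_option pmass_comm => q1.
  have <- : \sum_J pmass Pr (xi t) (Some J) = 1 - p_comm by rewrite -q1 addrC addKr.
  by apply: eq_bigr => J _; rewrite mul1r.
rewrite unlock /run_time; under eq_integral do rewrite -sumEFin.
rewrite ge0_integral_sum //; first last.
- by move=> t w _; rewrite lee_fin.
- move=> t; apply/measurable_EFinP.
  exact: (measurable_finite (sampling_meas t) (step_time tau)).
rewrite (eq_bigr (fun=> (p_comm * tau + (1 - p_comm))%:E)); last first.
  by move=> t _; rewrite -(one t) unlock.
by rewrite sumEFin sumr_const card_ord mulr_natl.
Qed.

End Sampling.

Section StepSizes.
Variable R : realType.

Lemma comm_probabilityE (gamma r M : R) : 0 < gamma -> 0 < r -> 0 < M ->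
  (1 + gamma * (M / (gamma * r)))^-1 = r / (r + M).
Proof. by move=> g0 r0 M0; field; rewrite !gt_eqF //= ?addr_gt0. Qed.

(** Here [r] stands for kappa_comm / gamma and [M] for m + kappa_s. The choice of
    the communication probability balances the two terms of the minimum: both
    are at least [(r + M)^-1 / alpha]. *)
Lemma step_size_lower (alpha Lam r M p : R) (X : set R) :
  0 < alpha -> 0 < Lam -> 0 < M -> r = 2 * Lam / alpha -> p = r / (r + M) ->
  (forall x, X x -> (1 - p) / (alpha * M) <= x) -> X !=set0 ->
  (r + M)^-1 <= alpha * Num.min (p / Lam) (inf X).
Proof.
move=> a0 L0 M0 rE pE Xlb Xn0.
have r0 : 0 < r by rewrite rE divr_gt0 // mulr_gt0.
have rM0 : 0 < r + M by rewrite addr_gt0.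
rewrite mulrC -ler_pdivrMr // le_min; apply/andP; split; last first.
  apply: lb_le_inf => // x /Xlb; rewrite pE.
  by rewrite (_ : (1 - r / (r + M)) / (alpha * M) = (r + M)^-1 / alpha) //; field;
    rewrite !gt_eqF.
rewrite pE {1}rE ler_pdivlMr //.
have -> : r / (r + M) = 2 * ((r + M)^-1 / alpha * Lam).
  by rewrite {1}rE; field; rewrite !gt_eqF.
rewrite -rE ler_peMl // ?ler1n // mulr_ge0 ?ltW // divr_gt0 ?invr_gt0 //.
Qed.

(** The expected duration of one step is [(M + tau r) / (r + M)], and its
    denominator cancels with the lower bound on [a]. *)
Lemma expected_time_bound (a r M tau p c l K : R) :
  0 < r -> 0 < M -> 0 <= tau -> p = r / (r + M) -> (r + M)^-1 <= a -> 0 <= c * l ->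
  a * K <= c * l -> 0 <= K ->
  K * (p * tau + (1 - p)) <= c * ((2 * M + tau * r) * l).
Proof.
move=> r0 M0 t0 pE ra cl aK K0; have rM0 : 0 < r + M by rewrite addr_gt0.
have -> : p * tau + (1 - p) = (r + M)^-1 * (M + tau * r).
  by rewrite pE; field; rewrite gt_eqF.
have q0 : 0 <= M + tau * r by rewrite addr_ge0 ?mulr_ge0 // ltW.
have KA : K * (r + M)^-1 <= c * l.
  by apply: le_trans aK; rewrite mulrC ler_wpM2r.
rewrite [leLHS]mulrA; apply: (le_trans (ler_wpM2r q0 KA)).
have := mulr_ge0 cl (ltW M0); lra.
Qed.

End StepSizes.

(** * The convergence theorem *)

Theorem theorem1 (R : realType) :
  exists2 c : R, 0 < c &
  forall (n m d E : nat) (n_gt1 : (1 < n)%N) (m_gt0 : (0 < m)%N)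
    (d_gt0 : (0 < d)%N)
    (adj : rel 'I_n) (src dst : 'I_E -> 'I_n) (mu : 'I_E -> R)
    (sigma : 'I_n -> R) (f : 'I_n -> 'I_m -> 'rV[R]_d -> R)
    (L : 'I_n -> 'I_m -> R) (P : 'I_n -> 'I_m -> 'M[R]_d) (W : 'M[R]_n)
    (theta_star : 'rV[R]_d) (z0 : 'I_n -> 'I_m -> 'rV[R]_d),
  connected_graph adj ->
  edge_orientation adj src dst ->
  (forall e, 0 < mu e) ->
  (forall i, 0 < sigma i) ->
  (forall i j, convex_function [set: 'rV[R]_d] (f i j)) ->
  (forall i j, twice_differentiable (f i j)) ->
  (forall i j, smooth (L i j) (f i j)) ->
  (forall i j, is_orthogonal_projector (P i j)
                 (orthogonal_compl (common_hessian_kernel (f i j)))) ->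
  (forall x, objective sigma f theta_star <= objective sigma f x) ->
  let A := A_comm d src dst mu in
  W *t (1%:M : 'M[R]_d) = A *m A^T ->
  let ASigmaA := A^T *m Sigma_comm d sigma *m A in
  let ADMA := A^T *m invmx (D_M sigma L P) *m A in
  let gamma := lambda_min_pos W / lambda_max W in
  let kappa_s := sup (range (fun i => (1 + \sum_(j < m) L i j) / sigma i)) in
  let kappa_comm := gamma * (lambda_max ASigmaA / lambda_min_pos ADMA) in
  let p_comm := (1 + gamma * ((m%:R + kappa_s) / kappa_comm))^-1 in
  let p i j := (1 - p_comm) * (1 + L i j / sigma i)
                 / \sum_(j' < m) (1 + L i j' / sigma i) in
  let alpha := 2 * lambda_min_pos ADMA in
  let eta := Num.min (p_comm / lambda_max ASigmaA)
               (inf (range (fun ij : 'I_n * 'I_m =>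
                  p ij.1 ij.2
                    / (alpha * (1 + (sigma ij.1)^-1 * L ij.1 ij.2))))) in
  let rate := 1 - alpha * eta / 2 in
  exists C0 eps0 : R, [/\ 0 < C0, 0 < eps0 &
    forall (dsp : measure_display) (T : measurableType dsp)
      (Pr : probability T R) (xi : nat -> T -> dvr_choice n m),
    dvr_sampling p_comm p Pr xi ->
    (forall t : nat, (0 < t)%N ->
       ('E_Pr[fun w => sq_error theta_star
                (dvr_run sigma f W p_comm p alpha eta z0 (xi ^~ w) t)]
        <= (C0 * rate ^+ t)%:E)%E) /\
    (forall tau eps : R, 0 <= tau -> 0 < eps <= eps0 ->
       exists2 K : nat, is_iteration_count C0 rate eps K &
         ('E_Pr[fun w => run_time tau (xi ^~ w) K]
          <= (c * ((2 * (m%:R + kappa_s) + tau * (kappa_comm / gamma))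
                     * ln eps^-1))%:E)%E)].
Proof.
exists 5 => // n m d E n_gt1 m_gt0 d_gt0 adj src dst mu sigma f L P W theta_star z0.
move=> conn edges mu_gt0 sigma_gt0 f_conv f_twice f_smooth P_proj theta_min A WA.
move=> ASigmaA ADMA gamma kappa_s kappa_comm p_comm p alpha eta rate.
pose B := incidence src dst mu.
have f_diff i j x : differentiable (f i j) x := (f_twice i j).1 x.
have f_diff2 i j x : differentiable (grad (f i j)) x := (f_twice i j).2 x.
have L_ge0 i j : 0 <= L i j := smooth_const_ge0 d_gt0 (f_smooth i j).
have P_sym i j : (P i j)^T = P i j by case: (P_proj i j).
have P_idem i j : P i j *m P i j = P i j by case: (P_proj i j).
have WE : W = B *m B^T := gossip_matrixE d_gt0 WA.
have B_neq0 : B != 0 := incidence_neq0 n_gt1 conn edges mu_gt0.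
pose Dm i := sigma i + lambda_max (\sum_(j < m) L i j *: P i j).
have Dm_ge i : sigma i <= Dm i.
  rewrite lerDl lambda_max_ge0 //; first exact: weighted_projectors_sym.
  exact: weighted_projectors_psd.
have Dm_gt0 i : 0 < Dm i by apply: lt_le_trans (Dm_ge i).
have si_gt0 i : 0 < (sigma i)^-1 by rewrite invr_gt0.
have Di_gt0 i : 0 < (Dm i)^-1 by rewrite invr_gt0.
pose GS := edge_gram src dst mu (fun i => (sigma i)^-1).
pose GD := edge_gram src dst mu (fun i => (Dm i)^-1).
have GS_sym : GS^T = GS := edge_gram_sym _ _ _ _.
have GD_sym : GD^T = GD := edge_gram_sym _ _ _ _.
have GS_psd : psd GS := edge_gram_psd _ _ _ (fun i => ltW (si_gt0 i)).
have GD_psd : psd GD := edge_gram_psd _ _ _ (fun i => ltW (Di_gt0 i)).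
have GS_neq0 : GS != 0 := edge_gram_neq0 si_gt0 B_neq0.
have GD_neq0 : GD != 0 := edge_gram_neq0 Di_gt0 B_neq0.
pose Lam := lambda_max GS; pose mu0 := lambda_min_pos GD.
have LamE : lambda_max ASigmaA = Lam.
  by rewrite /ASigmaA /Sigma_comm A_comm_gram lambda_max_tens1.
have mu0E : lambda_min_pos ADMA = mu0.
  by rewrite /ADMA /D_M invmx_diag_tens1 // A_comm_gram lambda_min_pos_tens1.
have Lam_gt0 : 0 < Lam by apply: lambda_max_gt0.
have mu0_gt0 : 0 < mu0 by apply: lambda_min_pos_gt0.
have W_sym : W^T = W by rewrite WE trmx_mul trmxK.
have W_psd : psd W.
  move=> q X; rewrite WE (_ : X^T *m _ = (B^T *m X)^T *m (B^T *m X)).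
    exact: mxtrace_gram_ge0.
  by rewrite trmx_mul trmxK !mulmxA.
have W_neq0 : W != 0.
  apply: contraNneq B_neq0 => W0.
  have : \tr ((B^T)^T *m B^T) == 0 by rewrite trmxK -WE W0 mxtrace0.
  by rewrite mxtrace_gram_eq0 -{2}[B]trmxK => /eqP ->; rewrite trmx0.
have gamma_gt0 : 0 < gamma by rewrite divr_gt0 ?lambda_min_pos_gt0 ?lambda_max_gt0.
pose r := Lam / mu0; have r_gt0 : 0 < r by rewrite divr_gt0.
have kcE : kappa_comm = gamma * r by rewrite /kappa_comm LamE mu0E.
have alphaE : alpha = 2 * mu0 by rewrite /alpha mu0E.
have alpha_gt0 : 0 < alpha by rewrite alphaE mulr_gt0.
have rE : r = 2 * Lam / alpha by rewrite alphaE /r; field; rewrite gt_eqF.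
have kgE : kappa_comm / gamma = r by rewrite kcE mulrC mulKf // gt_eqF.
have kappa_sP i : \sum_j L i j / sigma i <= kappa_s.
  apply: (@le_trans _ _ ((1 + \sum_(j < m) L i j) / sigma i)).
    by rewrite -mulr_suml ler_pM2r // lerDr.
  apply: ub_le_sup; last by exists i.
  exists (\sum_i (1 + \sum_(j < m) L i j) / sigma i) => _ [i' _ <-].
  rewrite (bigD1 i') //= lerDl; apply: sumr_ge0 => i'' _.
  by rewrite divr_ge0 ?(ltW (sigma_gt0 _)) // addr_ge0 // sumr_ge0.
pose M := m%:R + kappa_s.
pose i0 : 'I_n := Ordinal (ltnW n_gt1); pose j0 : 'I_m := Ordinal m_gt0.
have Ls_ge0 i j : 0 <= L i j / sigma i by rewrite divr_ge0 // ltW.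
have M_gt0 : 0 < M.
  rewrite ltr_pwDl ?ltr0n // (le_trans _ (kappa_sP i0)) //.
  by apply: sumr_ge0.
have pcE : p_comm = r / (r + M) by rewrite /p_comm kcE comm_probabilityE.
have rM_gt0 : 0 < r + M by rewrite addr_gt0.
have pc_gt0 : 0 < p_comm by rewrite pcE divr_gt0.
have pc_lt1 : 0 < 1 - p_comm.
  by rewrite subr_gt0 pcE ltr_pdivrMr // mul1r ltrDl.
have w_gt0 i j : 0 < 1 + L i j / sigma i by rewrite ltr_wpDr.
have wsum_gt0 i : 0 < \sum_(j < m) (1 + L i j / sigma i).
  rewrite (bigD1 j0) //= ltr_wpDr //; apply: sumr_ge0 => j _; exact: ltW.
have wsum_le i : \sum_(j < m) (1 + L i j / sigma i) <= M.
  by rewrite big_split /= sumr_const card_ord lerD2l.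
have p_le1 i j : p i j <= 1.
  rewrite /p ler_pdivrMr // mul1r (bigD1 j) //=.
  apply: (@le_trans _ _ (1 * (1 + L i j / sigma i))); last first.
    by rewrite mul1r lerDl; apply: sumr_ge0 => j' _; exact: ltW.
  by rewrite ler_pM2r // lerBlDr lerDl ltW.
have ratioE i j : p i j / (alpha * (1 + (sigma i)^-1 * L i j))
    = (1 - p_comm) / (alpha * \sum_(j < m) (1 + L i j / sigma i)).
  rewrite /p [(sigma i)^-1 * _]mulrC.
  have := wsum_gt0 i; move: (\sum_(j' < m) _) (w_gt0 i j) => S.
  move: (1 + _ / _) => w w0 S0.
  by field; rewrite !gt_eqF.
have ratio_ge0 i j : 0 <= p i j / (alpha * (1 + (sigma i)^-1 * L i j)).
  by rewrite ratioE ltW // divr_gt0 // mulr_gt0.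
(* The ratio in the definition of eta depends on i only, and the sum in its
   denominator is at most m + kappa_s. *)
have step_lower : (r + M)^-1 <= alpha * eta.
  rewrite /eta LamE; apply: step_size_lower => //; last first.
    by exists (p i0 j0 / (alpha * (1 + (sigma i0)^-1 * L i0 j0))), (i0, j0).
  move=> _ [[i j] _ <-] /=; rewrite ratioE ler_pM2l //.
  by rewrite lef_pV2 ?posrE; [rewrite ler_pM2l | apply: mulr_gt0..].
have ae_gt0 : 0 < alpha * eta by apply: lt_le_trans step_lower; rewrite invr_gt0.
have eta_gt0 : 0 < eta by rewrite -(pmulr_rgt0 _ alpha_gt0).
have eta_comm : eta * Lam <= p_comm.
  by rewrite -ler_pdivlMr // /eta LamE ge_min lexx.
have eta_comp i j : alpha * eta * (1 + L i j / sigma i) <= p i j.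
  have : eta <= p i j / (alpha * (1 + (sigma i)^-1 * L i j)).
    rewrite /eta ge_min; apply/orP; right; apply: ge_inf; last by exists (i, j).
    by exists 0 => _ [[i' j'] _ <-].
  rewrite [(sigma i)^-1 * _]mulrC ler_pdivlMr; last by apply: mulr_gt0.
  by rewrite mulrA [eta * alpha]mulrC.
have ae_le1 : alpha * eta <= 1.
  apply: le_trans (p_le1 i0 j0); apply: le_trans (eta_comp i0 j0).
  by rewrite ler_peMr ?(ltW ae_gt0) // lerDl.
have rate_ge0 : 0 <= rate by rewrite /rate; lra.
have [ws wsE] : exists ws, (\matrix_(i < n) (sigma i *: theta_star
    + \sum_j grad (f i j) theta_star)) = B *m B^T *m ws.
  apply: (gossip_range n_gt1 conn edges mu_gt0).
  by under eq_bigr do rewrite rowK; apply: objective_stationary theta_min.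
(* The edge variables B^T ws are the dual optimum towards which w is driven. *)
have ws_opt i : row i (W *m ws) = sigma i *: theta_star + \sum_j grad (f i j) theta_star.
  by rewrite WE -wsE rowK.
have W_const (x : 'rV[R]_d) : W *m (\matrix_(i < n) x) = 0.
  apply/matrixP => a b; rewrite [LHS]mxE [RHS]mxE.
  have Wac c : W a c = row c (B *m B^T) 0 a by rewrite [RHS]mxE -WE -[in LHS]W_sym mxE.
  under eq_bigr => c _ do rewrite Wac [X in _ * X]mxE.
  by rewrite -mulr_suml -summxE gossip_row_sum mxE mul0r.
have mu0_le : mu0 <= Lam.
  have GD2 : 0 < \tr ((GD *m 1%:M)^T *m (GD *m 1%:M)).
    by apply: mxtrace_gram_gt0; rewrite mulmx1.
  rewrite -(ler_pM2r GD2) (le_trans (psd_spectral_gap _ GD_sym GD_psd)) //.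
  apply: le_trans (rayleigh_le_lambda_max _ GS_sym).
  rewrite !edge_gram_quadratic; apply: ler_sum => i _.
  by rewrite ler_wpM2r ?dotp_ge0 // lef_pV2 // posrE.
have err_le s w : sq_error theta_star s
    <= alpha * (\sum_i (sigma i)^-1) * lyapunov sigma f W alpha theta_star ws s w.
  by apply: sq_error_le_lyapunov.
pose s0 := dvr_init sigma f z0.
pose V0 := alpha * (\sum_i (sigma i)^-1) * lyapunov sigma f W alpha theta_star ws s0 0.
have sis_ge0 : 0 <= \sum_i (sigma i)^-1 by apply: sumr_ge0 => i _; exact: ltW.
have V0_ge0 : 0 <= V0.
  apply: le_trans (err_le s0 0).
  by apply: sumr_ge0 => i _; rewrite mulr_ge0 ?sqr_ge0 // divr_ge0.
pose C0 := V0 + 1; have C0_gt0 : 0 < C0 by rewrite ltr_wpDl.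
(* The bounds on eps are those under which the iteration count is linear in
   ln eps^-1; adding 1 to V0 makes C0 positive even at the optimum. *)
exists C0, (Num.min C0^-1 (expR (-1))); split => //.
  by rewrite lt_min invr_gt0 C0_gt0 expR_gt0.
move=> dsp T Pr xi samp; split.
  move=> t _.
  pose step (c : dvr_choice n m) (x : dvr_state R n m d * 'M[R]_(n, d)) :=
    (dvr_step sigma f W p_comm p alpha eta c x.1, dual_step p_comm eta c x.1 x.2).
  have runE c u : dvr_run sigma f W p_comm p alpha eta z0 c u
      = (chain step (s0, 0) c u).1.
    by elim: u => //= u ->.
  have -> : (fun w => sq_error theta_star (dvr_run sigma f W p_comm p alpha eta z0 (xi ^~ w) t))
      = (fun w => sq_error theta_star (chain step (s0, 0) (xi ^~ w) t).1).
    by apply/funext => w; rewrite runE.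
  have [meas indep _ _] := samp.
  pose V (x : dvr_state R n m d * 'M[R]_(n, d)) :=
    alpha * (\sum_i (sigma i)^-1) * lyapunov sigma f W alpha theta_star ws x.1 x.2.
  apply: (@le_trans _ _ (V0 * rate ^+ t)%:E); last first.
    by rewrite lee_fin ler_wpM2r ?exprn_ge0 // lerDl.
  apply: (@expectation_chain_le R dsp T Pr _ None xi meas indep _ step (s0, 0)
    (fun x => sq_error theta_star x.1) V (fun x => dual_consistent sigma f W x.1 x.2)) => //.
  - by move=> x; apply: sumr_ge0 => i _; rewrite mulr_ge0 ?sqr_ge0 // divr_ge0.
  - by move=> x _; apply: err_le.
  - move=> i /=; rewrite mulmx0 row0 rowK scalerA mulrN mulfV ?gt_eqF //.
    by rewrite scaleN1r addNr.
  - by move=> c [s w] /= inv; apply: dual_consistent_step.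
  move=> u [s w] /= inv.
  rewrite /V /= mulrCA.
  under eq_bigr do rewrite mulrCA.
  rewrite -mulr_sumr; apply: ler_wpM2l; first by rewrite mulr_ge0 // ltW.
  apply: (@lyapunov_drift R n m d sigma f L W p_comm p alpha eta theta_star ws
    sigma_gt0 W_sym W_const ws_opt f_diff L_ge0 f_smooth f_conv alpha_gt0 eta_gt0
    eta_comp Lam mu0 (fun i => (Dm i)^-1)) => //.
  - by move=> X; rewrite WE; apply: gossip_upper.
  - move=> X; have := edge_gram_upper src dst mu (fun i => (sigma i)^-1) (B^T *m X).
    by rewrite trmx_mul trmxK -!mulmxA WE -mulmxA.
  - by move=> X; rewrite WE; apply: edge_gram_lower.
  - move=> i e z /=; apply: node_dual_bound => // j.
    + exact: (grad_diff_projector (f_diff i j) (f_conv i j) (f_diff2 i j) _ _ (P_proj i j)).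
    + exact: grad_sqr_le_sym_bregman.
    + exact: sym_bregman_ge0.
  - by move=> c; apply: pmass_ge0.
  - exact: (sum_pmass Pr (sampling_meas samp u)).
  - exact: (pmass_comm samp).
  - exact: (pmass_comp samp).
move=> tau eps tau_ge0 /andP[eps_gt0]; rewrite le_min => /andP[epsC eps1].
have [K KP aK] := iteration_count_bound C0_gt0 ae_gt0 ae_le1 eps_gt0 epsC eps1.
exists K => //; rewrite (expectation_run_time samp) // lee_fin kgE.
apply: (expected_time_bound r_gt0 M_gt0 tau_ge0 pcE step_lower _ aK) => //.
by apply: le_trans aK; rewrite mulr_ge0 // ltW.
Qed.
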